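(* Consider the load-balancing system described in the context, operated under any load balancing policy belonging to the set $\Pi$, and let $S=(S_{i,m})$ be distributed according to the stationary distribution of the state process. Let $w_u=\max\{(1-p)\mu_1,\mu_2\}$, $w_l=\min\{(1-p)\mu_1,\mu_2\}$, $\mu_{\max}=\max\{\mu_1,\mu_2\}$ and $k=\left(1+\frac{w_u b}{w_l}\right)\left(\frac{1+\mu_1+\mu_2}{w_l}+2\mu_1\right)$. If $N$ satisfies $$\frac{w_lN^{0.5-\alpha}}{1+\mu_1+\mu_2} \geq \log N \geq \frac{3.5}{\min\left(\frac{\mu_1}{16\mu_{\max}},\frac{\mu_2}{12\mu_{\max}},\frac{\mu_1\mu_2}{40\mu_{\max}}\right)},$$ then $$\mathbb E\left[\max\left\{\sum_{i=1}^{b} S_i- \lambda -\frac{k\log N}{\sqrt{N}},0\right\}\right] \leq \frac{7\mu_{\max}}{\sqrt{N}\log N}.$$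
   Context: System: $N$ identical servers. Jobs arrive according to a Poisson process of rate $\lambda N$ with $\lambda=1-N^{-\alpha}$, $0<\alpha<0.5$. Service times are Coxian-2 with parameters $(\mu_1,\mu_2,p)$, $\mu_1,\mu_2>0$, $0\le p<1$: a job in service completes phase 1 at rate $\mu_1$; then with probability $1-p$ it leaves, and with probability $p$ it enters phase 2, which it completes at rate $\mu_2$ and then leaves. It is assumed that $\frac{1}{\mu_1}+\frac{p}{\mu_2}=1$ (unit mean service time). Each server can hold at most $b$ jobs (one in service and $b-1$ in its buffer); a job routed to a server holding $b$ jobs is blocked (discarded). For $t\ge0$, $Q_{j,m}(t)$ ($1\le j\le b$, $m\in\{1,2\}$) is the fraction of servers holding $j$ jobs whose job in service is in phase $m$; $Q_{0,1}(t)$ is the fraction of idle servers and $Q_{0,2}(t)=0$. Let $S_{i,m}(t)=\sum_{j\ge i}Q_{j,m}(t)$ and $S_i(t)=S_{i,1}(t)+S_{i,2}(t)$ (fraction of servers with at least $i$ jobs). The state space is $\mathcal S^{(N)}=\{s\in\mathbb R^{b\times 2}: 1\ge s_{1,m}\ge\cdots\ge s_{b,m}\ge0,\ s_{1,1}+s_{1,2}\le 1,\ Ns_{i,m}\in\mathbb N\ \forall i,m\}$, and $s_i=s_{i,1}+s_{i,2}$. A load balancing policy dispatches each arriving job to a server based on the current state $S(t)$, and is assumed to make the finite-state CTMC $\{S(t)\}$ irreducible, so it has a unique stationary distribution; $S_{i,m}, S_i$ denote the corresponding stationary random variables. For $s\in\mathcal S^{(N)}$, $A_1(s)$ is the probability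 that an arriving job is routed to a busy (non-idle) server when the state is $s$. The policy set $\Pi$ consists of all such policies for which $A_1(s)\le \frac{1}{\sqrt N}$ for every $s\in\mathcal S^{(N)}$ with $s_1\le \lambda+\frac{1+\mu_1+\mu_2}{\min\{(1-p)\mu_1,\mu_2\}}\frac{\log N}{\sqrt N}$. *)

(* Defs.v *)
From HB Require Import structures.
From mathcomp Require Import all_boot all_order all_algebra.
From mathcomp Require Import reals exp.
Set Implicit Arguments. Unset Strict Implicit. Unset Printing Implicit Defensive.
Import Order.TTheory GRing.Theory Num.Theory.
Local Open Scope ring_scope.

(* Encoding of a state s in S^(N).  A configuration x assigns to each index
   (i, m) : 'I_b * 'I_2 the integer N * s_{i+1, m+1} in {0..N}
   (i.e. level index i : 'I_b stands for level i+1 in 1..b, and phase index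
   m : 'I_2 stands for phase m+1 in {1,2}). *)
Definition cfg (N b : nat) := {ffun 'I_b * 'I_2 -> 'I_N.+1}.

Definition validb (N b : nat) (x : cfg N b) : bool :=
  [forall m : 'I_2, forall i : 'I_b, forall j : 'I_b,
      (i <= j)%N ==> (x (j, m) <= x (i, m))%N]
  && [forall i : 'I_b, (x (i, ord0) + x (i, ord_max) <= N)%N].

Definition state (N b : nat) := {x : cfg N b | validb x}.


Section Model.
Variables (N b : nat).

Definition cnt (x : state N b) : {ffun 'I_b * 'I_2 -> nat} :=
  [ffun k : 'I_b * 'I_2 => nat_of_ord (val x k)].

(* lvl x l m = N * s_{l, m+1} for 1 <= l <= b, and 0 for l = 0 or l > b *)
Definition lvl (x : state N b) (l : nat) (m : 'I_2) : nat :=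
  (\sum_(i < b | i.+1 == l) cnt x (i, m))%N.

(* Qcnt x j m = N * Q_{j, m+1}: number of servers with j jobs whose job in
   service is in phase m+1 (j = 0: idle servers, all counted in phase 1). *)
Definition Qcnt (x : state N b) (j : nat) (m : 'I_2) : nat :=
  if j == 0%N then (if nat_of_ord m == 0%N then N - (lvl x 1 ord0 + lvl x 1 ord_max) else 0)%N
  else (lvl x j m - lvl x j.+1 m)%N.

Definition s1 {R : realType} (x : state N b) : R :=
  (lvl x 1 ord0 + lvl x 1 ord_max)%:R / N%:R.
Definition sumS {R : realType} (x : state N b) : R :=
  \sum_(i < b) ((cnt x (i, ord0))%:R + (cnt x (i, ord_max))%:R) / N%:R.

(* arrival at a server holding j jobs (0 <= j < b), job in service in phase
   m+1 (for j = 0 the new job starts in phase 1) *)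
Definition arr (x : state N b) (j : nat) (m : 'I_2) : {ffun 'I_b * 'I_2 -> nat} :=
  [ffun k : 'I_b * 'I_2 => (cnt x k + ((nat_of_ord k.1 == j)
      && (nat_of_ord k.2 == (if j == 0%N then 0%N else nat_of_ord m))))%N].
(* phase 1 -> phase 2 at a server holding j >= 1 jobs *)
Definition ph (x : state N b) (j : nat) : {ffun 'I_b * 'I_2 -> nat} :=
  [ffun k : 'I_b * 'I_2 => if (k.1 < j)%N then
               (if nat_of_ord k.2 == 0%N then cnt x k - 1 else cnt x k + 1)%N
             else cnt x k].
(* departure after phase 1 at a server holding j >= 1 jobs
   (next job, if any, starts in phase 1) *)
Definition dep1 (x : state N b) (j : nat) : {ffun 'I_b * 'I_2 -> nat} :=
  [ffun k : 'I_b * 'I_2 => if (k.1.+1 == j) && (nat_of_ord k.2 == 0%N) then (cnt x k - 1)%N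
             else cnt x k].
(* departure after phase 2 at a server holding j >= 1 jobs
   (next job, if any, starts in phase 1) *)
Definition dep2 (x : state N b) (j : nat) : {ffun 'I_b * 'I_2 -> nat} :=
  [ffun k : 'I_b * 'I_2 => if nat_of_ord k.2 == 1%N then
               (if (k.1 < j)%N then cnt x k - 1 else cnt x k)%N
             else (if (k.1.+1 < j)%N then cnt x k + 1 else cnt x k)%N].

(* A policy: A x j m = probability that an arriving job is routed to a server
   holding j jobs (0 <= j <= b) whose job in service is in phase m+1, when
   the state is x. *)
Definition policy (R : realType) := state N b -> 'I_b.+1 -> 'I_2 -> R.

Definition valid_policy {R : realType} (A : policy R) : Prop :=
  forall x, (forall j m, 0 <= A x j m)
    /\ \sum_(j < b.+1) \sum_(m < 2) A x j m = 1
    /\ (forall (j : 'I_b.+1) m, Qcnt x j m = 0%N -> A x j m = 0).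

Definition A1 {R : realType} (A : policy R) (x : state N b) : R :=
  \sum_(j < b.+1 | (0 < j)%N) \sum_(m < 2) A x j m.

Definition rate {R : realType} (lam mu1 mu2 p : R) (A : policy R)
    (x y : state N b) : R :=
  \sum_(j < b.+1 | (j < b)%N) \sum_(m < 2)
      lam * N%:R * A x j m * (arr x j m == cnt y)%:R
  + \sum_(j < b) mu1 * (Qcnt x j.+1 ord0)%:R *
      (p * (ph x j.+1 == cnt y)%:R + (1 - p) * (dep1 x j.+1 == cnt y)%:R)
  + \sum_(j < b) mu2 * (Qcnt x j.+1 ord_max)%:R * (dep2 x j.+1 == cnt y)%:R.

Definition irreducible {R : realType} (lam mu1 mu2 p : R) (A : policy R) : Prop :=
  forall x y : state N b, connect (fun u v => 0 < rate lam mu1 mu2 p A u v) x y.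

Definition stationary {R : realType} (lam mu1 mu2 p : R) (A : policy R)
    (pi : state N b -> R) : Prop :=
  (forall x, 0 <= pi x) /\ \sum_x pi x = 1 /\
  forall y, \sum_(x | x != y) pi x * rate lam mu1 mu2 p A x y
            = pi y * \sum_(z | z != y) rate lam mu1 mu2 p A y z.

Definition in_Pi {R : realType} (lam mu1 mu2 p : R) (A : policy R) : Prop :=
  forall x, s1 x <= lam + (1 + mu1 + mu2) / Num.min ((1 - p) * mu1) mu2
                            * ln (N%:R) / Num.sqrt (N%:R)
            -> A1 A x <= 1 / Num.sqrt (N%:R).

End Model.

(* Main.v *)
Require Import Defs.
From HB Require Import structures.
From mathcomp Require Import all_boot all_order all_algebra.
From mathcomp Require Import zify ring lra.
From mathcomp Require Import reals sequences exp.
Import Order.TTheory GRing.Theory Num.Theory.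
Local Open Scope ring_scope.

(** Write u, v for the fractions of servers busy in phases 1 and 2, q for the
    number of waiting jobs divided by N, delta = log N / sqrt N, and let c
    be such that at most a fraction 1 / sqrt N of the arrivals joins busy servers
    while u + v <= lam + c delta.  The proof exhibits affine functions of
    (u, v, q) ("facets") whose maximum dominates u + v + q - lam and such that
    every facet within delta / 4 of the maximum has drift at most -G delta / 4,
    G = 1 + mu1 + mu2, once the maximum exceeds (c + b c / 2) delta:
    - q + (c - 1/4) delta: when it is active, u + v <= lam + c delta, so few jobs
      join the queues while they empty at rate at least wl q / b;
    - X = u + q - lam / mu1, with drift at most lam - mu1 u;
    - if mu2 >= 1, the total S = u + v + q - lam itself;
    - if mu2 < 1, the workload W = X + (v - p lam / mu2) / mu2, with drift at
      most lam - (u + v), and U = W - (u + v - lam - c' delta) / w1 with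
      w1 = (1 - p) mu1, which takes over from W when u + v is small.
    The sum of the exponentials of N theta times the facets, theta of order delta,
    is then a Foster-Lyapunov function.  Its stationary mean is at most
    polynomial in N times exp (N theta (c + b c / 2) delta), and N theta delta is
    of order log^2 N, so the excess over k delta is superpolynomially small. *)

(** * Configurations and transitions *)

Lemma ord2P (m : 'I_2) : m = ord0 \/ m = ord_max.
Proof. by case: m => [[|[|//]] Hm]; [left | right]; apply: val_inj. Qed.

Section Configurations.
Variables N b : nat.
Implicit Types (x : state N b) (i j : 'I_b) (m : 'I_2).
Implicit Types t : {ffun 'I_b * 'I_2 -> nat}.

Lemma cnt_noninc x i j m : (i <= j)%N -> (cnt x (j, m) <= cnt x (i, m))%N.
Proof.
move=> le_ij; rewrite !ffunE; case/andP: (valP x) => /forallP/(_ m)/forallP/(_ i).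
by move=> /forallP/(_ j)/implyP/(_ le_ij).
Qed.

Lemma cnt_le_N x i : (cnt x (i, ord0) + cnt x (i, ord_max) <= N)%N.
Proof. by rewrite !ffunE; case/andP: (valP x) => _ /forallP/(_ i). Qed.

Lemma cnt_inj : injective (@cnt N b).
Proof.
move=> x y /ffunP exy; apply: val_inj; apply/ffunP => k; apply: val_inj.
by move: (exy k); rewrite !ffunE.
Qed.

(** [rate] detects a jump by equality with some [cnt y], so a target violating the state constraints
    would be lost; this criterion rules that out. *)
Lemma cnt_surj t :
    (forall i j m, (i <= j)%N -> (t (j, m) <= t (i, m))%N) ->
    (forall i, (t (i, ord0) + t (i, ord_max) <= N)%N) ->
  exists y : state N b, t = cnt y.
Proof.
move=> t_noninc t_le_N.
have t_lt k : (t k < N.+1)%N.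
  case: k => i m; have := t_le_N i.
  by case: (ord2P m) => ->; move: (t _) (t _) => *; lia.
pose z : cfg N b := [ffun k => Ordinal (t_lt k)].
have z_valid : validb z.
  apply/andP; split.
    apply/forallP => m; apply/forallP => i; apply/forallP => j.
    by apply/implyP => le_ij; rewrite !ffunE /=; exact: t_noninc.
  by apply/forallP => i; rewrite !ffunE /=.
exists (exist _ z z_valid); apply/ffunP => k.
by rewrite !ffunE.
Qed.

Lemma lvl_ord x i m : lvl x i.+1 m = cnt x (i, m).
Proof. by rewrite /lvl (eq_bigl (pred1 i)) ?big_pred1_eq. Qed.

Lemma lvl_gt x l m : (b < l)%N -> lvl x l m = 0%N.
Proof.
by move=> ltbl; rewrite /lvl big_pred0 // => i; have := ltn_ord i; lia.
Qed.

Lemma lvl_noninc x l l' m : (0 < l)%N -> (l <= l')%N -> (lvl x l' m <= lvl x l m)%N.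
Proof.
case: l => // l _; case: l' => // l' le_ll'.
have [lt_bl'|ge_bl'] := ltnP l' b; last by rewrite lvl_gt.
have lt_lb : (l < b)%N by lia.
rewrite (lvl_ord x (Ordinal lt_bl')) (lvl_ord x (Ordinal lt_lb)).
exact: cnt_noninc.
Qed.

Lemma lvl_le_N x l : (0 < l)%N -> (lvl x l ord0 + lvl x l ord_max <= N)%N.
Proof.
case: l => // l _; have [lt_lb|ge_lb] := ltnP l b; last by rewrite !lvl_gt.
by rewrite !(lvl_ord x (Ordinal lt_lb)) cnt_le_N.
Qed.

Lemma arrE x (j : nat) m k : arr x j m k =
  (lvl x k.1.+1 k.2 + ((nat_of_ord k.1 == j)
     && (nat_of_ord k.2 == (if j == 0%N then 0%N else nat_of_ord m))))%N.
Proof. by case: k => i m'; rewrite /arr ffunE lvl_ord. Qed.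

Lemma phE x (j : nat) k : ph x j k =
  if (k.1 < j)%N then
    (if nat_of_ord k.2 == 0%N then lvl x k.1.+1 k.2 - 1 else lvl x k.1.+1 k.2 + 1)%N
  else lvl x k.1.+1 k.2.
Proof. by case: k => i m'; rewrite /ph ffunE lvl_ord. Qed.

Lemma dep1E x (j : nat) k : dep1 x j k =
  if (k.1.+1 == j) && (nat_of_ord k.2 == 0%N) then (lvl x k.1.+1 k.2 - 1)%N
  else lvl x k.1.+1 k.2.
Proof. by case: k => i m'; rewrite /dep1 ffunE lvl_ord. Qed.

Lemma dep2E x (j : nat) k : dep2 x j k =
  if nat_of_ord k.2 == 1%N then
    (if (k.1 < j)%N then lvl x k.1.+1 k.2 - 1 else lvl x k.1.+1 k.2)%N
  else (if (k.1.+1 < j)%N then lvl x k.1.+1 k.2 + 1 else lvl x k.1.+1 k.2)%N.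
Proof. by case: k => i m'; rewrite /dep2 ffunE lvl_ord. Qed.

(** Entry [j], that is level [j + 1], grows by one. A server of class [(j, m)] makes level [j]
    strictly larger in phase [m], or for [j = 0] leaves room for one more busy server. *)
Lemma arr_valid x (j : nat) m : (j < b)%N -> (0 < Qcnt x j m)%N ->
  exists y : state N b, arr x j m = cnt y.
Proof.
move=> lt_jb; rewrite /Qcnt => Q_gt0; apply: cnt_surj => [i i' m'|i] .
  rewrite leq_eqVlt => /orP[/eqP/val_inj->//|lt_ii'].
  rewrite !arrE /=.
  have := lvl_noninc x i.+1 i'.+1 m' isT (ltnW lt_ii').
  have [ei'|ni'] := eqVneq (i' : nat) j => /=; last by lia.
  case: ifP Q_gt0 => [/eqP j0|nj0 Q_gt0]; first by lia.
  have [em'|nm'] := eqVneq (m' : nat) m; last by lia.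
  have {em'} -> : m' = m by exact: val_inj.
  move: Q_gt0; rewrite -ei'.
  have := lvl_noninc x i.+1 i' m isT lt_ii'; lia.
rewrite !arrE /=.
have [ei|ni] := eqVneq (i : nat) j => /=; last by have := lvl_le_N x i.+1 isT; lia.
case: ifP Q_gt0 => [/eqP j0|/eqP nj0 Q_gt0].
  by case: ifP => // _; rewrite ei j0; lia.
move: Q_gt0; rewrite -ei; have := lvl_le_N x j; rewrite -ei.
have := lvl_noninc x i i.+1 ord0; have := lvl_noninc x i i.+1 ord_max.
by case: (ord2P m) => -> /=; lia.
Qed.

(** A server with exactly [j + 1] jobs makes level [j + 1] exceed level [j + 2] in phase 1, so the
    truncated subtractions are exact and monotonicity survives at the cut. *)
Lemma ph_valid x j : (0 < Qcnt x j.+1 ord0)%N ->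
  exists y : state N b, ph x j.+1 = cnt y.
Proof.
rewrite /Qcnt /= => Q_gt0; apply: cnt_surj => [i i' m' le_ii'|i].
  rewrite !phE /=.
  have := lvl_noninc x i.+1 i'.+1 m' isT le_ii'.
  have := lvl_noninc x i.+1 j.+1 m' isT; have := lvl_noninc x j.+2 i'.+1 m' isT.
  by case: (ord2P m') => -> /=; do 4?[case: ltnP => ?]; lia.
rewrite !phE /=; have := lvl_le_N x i.+1 isT.
have := lvl_noninc x i.+1 j.+1 ord0 isT.
by case: ltnP => ?; lia.
Qed.

Lemma dep1_valid x j : (0 < Qcnt x j.+1 ord0)%N ->
  exists y : state N b, dep1 x j.+1 = cnt y.
Proof.
rewrite /Qcnt /= => Q_gt0; apply: cnt_surj => [i i' m'|i].
  rewrite leq_eqVlt => /orP[/eqP/val_inj->//|lt_ii'].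
  rewrite !dep1E /=.
  have := lvl_noninc x i.+1 i'.+1 m' isT (ltnW lt_ii').
  case: (ord2P m') => -> /=; rewrite ?andbF ?andbT //.
  have [ei|ni] := eqVneq (i : nat) j; last by case: eqP; case: eqP; lia.
  rewrite ei eqxx; have := lvl_noninc x j.+2 i'.+1 ord0 isT.
  by case: eqP; lia.
rewrite !dep1E /=; have := lvl_le_N x i.+1 isT.
by case: ifP; rewrite ?andbF /=; lia.
Qed.

Lemma dep2_valid x j : (0 < Qcnt x j.+1 ord_max)%N ->
  exists y : state N b, dep2 x j.+1 = cnt y.
Proof.
rewrite /Qcnt /= => Q_gt0; apply: cnt_surj => [i i' m' le_ii'|i].
  rewrite !dep2E /=.
  have := lvl_noninc x i.+1 i'.+1 m' isT le_ii'.
  have := lvl_noninc x i.+1 j.+1 m' isT; have := lvl_noninc x j.+2 i'.+1 m' isT.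
  by case: (ord2P m') => -> /=; do 4?[case: ltnP => ?]; lia.
rewrite !dep2E /=; have := lvl_le_N x i.+1 isT.
have := lvl_noninc x i.+1 j.+1 ord_max isT.
by do 4?[case: ltnP => ?]; lia.
Qed.

End Configurations.

(** * The generator on functions of a linear statistic *)

Definition gen {R : realType} {S : finType} (r : S -> S -> R) (g : S -> R) (x : S) : R :=
  \sum_y r x y * (g y - g x).

Section Generator.
Variables (R : realType) (N b : nat).
Implicit Types (x : state N b) (i j : 'I_b) (m : 'I_2) (a f c : R).
Implicit Types t : {ffun 'I_b * 'I_2 -> nat}.

(* [N] times [a * u + f * v + c * q], for a raw configuration [t] that need not be
   a state *)
Definition lin a f c t : R :=
  \sum_(i < b) ((if i == 0 :> nat then a else c) * (t (i, ord0))%:R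
                + (if i == 0 :> nat then f else c) * (t (i, ord_max))%:R).

Lemma sum_ord_eq (k : nat) a : (k < b)%N -> \sum_(i < b) (i == k :> nat)%:R * a = a.
Proof.
move=> lt_kb; rewrite (bigD1 (Ordinal lt_kb)) //= eqxx mul1r big1 ?addr0 // => i.
by rewrite -val_eqE /= => /negPf ->; rewrite mul0r.
Qed.

Lemma lin_arr a f c x (j : nat) m : (j < b)%N -> (0 < Qcnt x j m)%N ->
  lin a f c (arr x j m) = lin a f c (cnt x)
    + (if j == 0%N then a else c).
Proof.
move=> lt_jb Q_gt0; apply/eqP; rewrite addrC -subr_eq -sumrB; apply/eqP.
rewrite -[RHS](sum_ord_eq j) //; apply: eq_bigr => i _.
rewrite !arrE /= -!lvl_ord.
have [->|nij] := eqVneq (i : nat) j; last by rewrite /= !addn0 mul0r; ring.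
case: ifP => [/eqP j0|nj0]; first by rewrite /= ?addn0 ?addn1 -?natr1; ring.
by case: (ord2P m) => -> /=; rewrite ?addn0 ?addn1 -?natr1; ring.
Qed.

Lemma lin_ph a f c x j : (0 < Qcnt x j.+1 ord0)%N ->
  lin a f c (ph x j.+1) = lin a f c (cnt x) + (f - a).
Proof.
rewrite /Qcnt /= => Q_gt0; apply/eqP; rewrite addrC -subr_eq -sumrB; apply/eqP.
have b_gt0 : (0 < b)%N by case: j Q_gt0 => j /=; lia.
(* Above entry 0 both phases carry the coefficient [c], so a phase change shows at entry 0 only. *)
rewrite -[RHS](sum_ord_eq 0) //; apply: eq_bigr => i _.
rewrite !phE /= -!lvl_ord.
have := lvl_noninc _ _ x i.+1 j.+1 ord0 isT.
case: ltnP => /= [lt_ij H|]; last by case: eqP => /= *; [lia | ring].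
by rewrite natrB ?natrD; [case: eqP => _ /=; ring | lia].
Qed.

Lemma lin_dep1 a f c x j : (0 < Qcnt x j.+1 ord0)%N ->
  lin a f c (dep1 x j.+1) = lin a f c (cnt x) - (if j == 0 :> nat then a else c).
Proof.
rewrite /Qcnt /= => Q_gt0; apply/eqP; rewrite addrC -subr_eq -sumrB; apply/eqP.
rewrite -[RHS](sum_ord_eq j) //; apply: eq_bigr => i _.
rewrite !dep1E /= -!lvl_ord andbT andbF eqSS.
have [->|nij] := eqVneq (i : nat) j; last by rewrite mul0r; ring.
by rewrite natrB /=; [ring | lia].
Qed.

Lemma lin_dep2 a f c x j : (0 < Qcnt x j.+1 ord_max)%N ->
  lin a f c (dep2 x j.+1) =
  lin a f c (cnt x) + (if j == 0 :> nat then - f else a - f - c).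
Proof.
rewrite /Qcnt /= => Q_gt0; apply/eqP; rewrite addrC -subr_eq -sumrB; apply/eqP.
have b_gt0 : (0 < b)%N by case: j Q_gt0 => j /=; lia.
(* [e] is the change at entry 0, where the server leaves phase 2 and restarts in phase 1 if a job
   waits; [e'] is the lost waiting job at entry [j]. Entries strictly between cancel. *)
pose e := if j == 0 :> nat then - f else a - f.
pose e' := if j == 0 :> nat then 0 else - c.
have -> : (if j == 0 :> nat then - f else a - f - c) = e + e'.
  by rewrite /e /e'; case: ifP => _; rewrite ?addr0.
rewrite -[X in _ = X + _](sum_ord_eq 0) // -[X in _ = _ + X](sum_ord_eq j) //.
rewrite -big_split; apply: eq_bigr => i _ /=; rewrite /e /e'.
rewrite !dep2E /= -!lvl_ord.
have := lvl_noninc _ _ x i.+1 j.+1 ord_max isT.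
have [le_ij|gt_ij] := leqP i j => H; last first.
  have [-> ->] : (i < j.+1)%N = false /\ (i.+1 < j.+1)%N = false by split; lia.
  by rewrite /= (gtn_eqF gt_ij); case: eqP => /= *; [lia | ring].
have -> : (i < j.+1)%N by lia.
have -> : (i.+1 < j.+1)%N = (i < j)%N by lia.
rewrite natrB /=; last by lia.
move: le_ij; rewrite leq_eqVlt => /orP[/eqP <-|lt_ij].
  by rewrite ltnn eqxx; case: eqP => _ /=; ring.
rewrite lt_ij natrD (ltn_eqF lt_ij).
have -> : (j == 0 :> nat) = false by lia.
by case: eqP => _ /=; ring.
Qed.

(** The classes with at least two jobs telescope to level 2, level [b + 1] being zero. *)
Lemma sum_Qcnt x m a c : (0 < b)%N ->
  \sum_(j < b) (Qcnt x j.+1 m)%:R * (if j == 0 :> nat then a else c)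
  = ((lvl x 1 m)%:R - (lvl x 2 m)%:R) * a + (lvl x 2 m)%:R * c.
Proof.
move=> b_gt0.
have QE k : (Qcnt x k.+1 m)%:R = (lvl x k.+1 m)%:R - (lvl x k.+2 m)%:R :> R.
  by rewrite /Qcnt /= natrB // lvl_noninc.
rewrite -(big_mkord predT (fun j : nat => (Qcnt x j.+1 m)%:R * (if j == 0%N then a else c))).
rewrite big_ltn //= QE; congr (_ + _).
rewrite (eq_big_nat _ _ (F2 := fun k => ((- (lvl x k.+2 m)%:R) - (- (lvl x k.+1 m)%:R)) * c)).
  by rewrite -mulr_suml telescope_sumr // lvl_gt // oppr0 sub0r opprK.
by move=> k /andP[k_gt0 _]; rewrite QE gtn_eqF // opprK addrC.
Qed.

Lemma sum_target x t (h : {ffun 'I_b * 'I_2 -> nat} -> R) a :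
  (a != 0 -> exists y : state N b, t = cnt y) ->
  \sum_(y : state N b) a * (t == cnt y)%:R * h (cnt y) = a * h t.
Proof.
have [->|a_neq0 /(_ isT)[y0 ->]] := eqVneq a 0.
  by rewrite mul0r big1 // => y _; rewrite !mul0r.
rewrite (bigD1 y0) //= eqxx mulr1 big1 ?addr0 // => y nyy0.
by rewrite (inj_eq (@cnt_inj _ _)) eq_sym (negPf nyy0) mulr0 mul0r.
Qed.

Lemma gen_rate (lam mu1 mu2 p : R) (A : policy N b R) x
    (h : {ffun 'I_b * 'I_2 -> nat} -> R) :
  valid_policy A ->
  gen (rate lam mu1 mu2 p A) (h \o @cnt N b) x =
  \sum_(j < b.+1 | (j < b)%N) \sum_(m < 2)
     lam * N%:R * A x j m * (h (arr x j m) - h (cnt x))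
  + \sum_(j < b) mu1 * (Qcnt x j.+1 ord0)%:R *
      (p * (h (ph x j.+1) - h (cnt x)) + (1 - p) * (h (dep1 x j.+1) - h (cnt x)))
  + \sum_(j < b) mu2 * (Qcnt x j.+1 ord_max)%:R * (h (dep2 x j.+1) - h (cnt x)).
Proof.
move=> A_valid; pose h' t := h t - h (cnt x).
have Q_gt0 k (j : nat) m : k * (Qcnt x j m)%:R != 0 -> (0 < Qcnt x j m)%N.
  by rewrite lt0n; apply: contraNneq => ->; rewrite mulr0.
rewrite /gen /rate /=.
under eq_bigr => y _ do rewrite -/(h' (cnt y)) !mulrDl.
rewrite !big_split /=; congr (_ + _ + _).
- under eq_bigr => y _ do rewrite mulr_suml.
  rewrite exchange_big; apply: eq_bigr => j lt_jb /=.
  under eq_bigr => y _ do rewrite mulr_suml.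
  rewrite exchange_big; apply: eq_bigr => m _ /=.
  rewrite (sum_target x) // => a_neq0; apply: arr_valid => //.
  rewrite lt0n; apply: contraNneq a_neq0 => Q0.
  by case: (A_valid x) => _ [_ ->]; rewrite ?mulr0.
- under eq_bigr => y _ do rewrite mulr_suml.
  rewrite exchange_big; apply: eq_bigr => j _ /=.
  set k := _ * (Qcnt _ _ _)%:R.
  have split_y (y : state N b) :
    k * (p * (ph x j.+1 == cnt y)%:R + (1 - p) * (dep1 x j.+1 == cnt y)%:R) * h' (cnt y)
    = k * p * (ph x j.+1 == cnt y)%:R * h' (cnt y)
      + k * (1 - p) * (dep1 x j.+1 == cnt y)%:R * h' (cnt y) by ring.
  rewrite (eq_bigr _ (fun y _ => split_y y)) big_split /= !(sum_target x).
  - by rewrite /h'; ring.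
  - move=> a_neq0; apply: dep1_valid; apply: (Q_gt0 _ (mu1 * (1 - p))).
    by rewrite mulrAC.
  - move=> a_neq0; apply: ph_valid; apply: (Q_gt0 _ (mu1 * p)).
    by rewrite mulrAC.
under eq_bigr => y _ do rewrite mulr_suml.
rewrite exchange_big; apply: eq_bigr => j _ /=.
by rewrite (sum_target x) // => a_neq0; apply: dep2_valid; apply: Q_gt0 a_neq0.
Qed.

(** An increment of [lin] depends only on the transition type and on whether the server holds no,
    one or more jobs, so the sum over server classes closes up in the first two levels. *)
Lemma gen_lin (lam mu1 mu2 p : R) (A : policy N b R) x (E : R -> R) a f c :
  (0 < b)%N -> valid_policy A ->
  let L := lin a f c (cnt x) in
  let incr d := E (L + d) - E L in
  exists2 Am, 0 <= Am <= A1 A x &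
  gen (rate lam mu1 mu2 p A) (fun y => E (lin a f c (cnt y))) x =
    lam * N%:R * ((1 - A1 A x) * incr a + Am * incr c)
    + mu1 * p * (lvl x 1 ord0)%:R * incr (f - a)
    + mu1 * (1 - p) * (((lvl x 1 ord0)%:R - (lvl x 2 ord0)%:R) * incr (- a)
                       + (lvl x 2 ord0)%:R * incr (- c))
    + mu2 * (((lvl x 1 ord_max)%:R - (lvl x 2 ord_max)%:R) * incr (- f)
             + (lvl x 2 ord_max)%:R * incr (a - f - c)).
Proof.
move=> b_gt0 A_valid L incr.
have [A_ge0 [A_sum A_Q]] := A_valid x.
(* The routing probability to busy servers that are not full; blocked arrivals contribute no
   increment. *)
exists (\sum_(j < b.+1 | (j < b)%N && (j != ord0)) \sum_(m < 2) A x j m).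
  rewrite sumr_ge0 => [/=|j _]; last by rewrite sumr_ge0.
  rewrite /A1 [leRHS](bigID (fun j : 'I_b.+1 => (j < b)%N)) /=.
  rewrite (eq_bigl (fun j : 'I_b.+1 => (0 < j)%N && (j < b)%N)); last first.
    by move=> j; rewrite andbC -val_eqE /= lt0n.
  by rewrite lerDl sumr_ge0 // => j _; rewrite sumr_ge0.
rewrite (gen_rate lam mu1 mu2 p A x (E \o lin a f c)) //=.
rewrite -/L.
congr (_ + _).
  rewrite -addrA; congr (_ + _).
    rewrite (eq_bigr (fun j : 'I_b.+1 => lam * N%:R * (\sum_(m < 2) A x j m)
        * incr (if j == 0 :> nat then a else c))); last first.
      move=> j lt_jb; rewrite mulr_sumr mulr_suml; apply: eq_bigr => m _.
      have [/A_Q ->|] := eqVneq (Qcnt x j m) 0%N; first by rewrite !(mulr0, mul0r).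
      by rewrite -lt0n => /lin_arr ->.
    rewrite (bigD1 ord0) //=.
    have -> : \sum_(m < 2) A x ord0 m = 1 - A1 A x.
      rewrite -A_sum [X in _ = X - _](bigD1 ord0) //= /A1.
      rewrite [X in _ = _ - X](eq_bigl (fun j : 'I_b.+1 => j != ord0)) ?addrK // => j.
      by rewrite -val_eqE /= lt0n.
    set Am := \sum_(_ < _ | _) \sum_(_ < _) A x _ _.
    rewrite (eq_bigr (fun j : 'I_b.+1 => lam * N%:R * incr c * (\sum_(m < 2) A x j m))).
      by rewrite -mulr_sumr -/Am; ring.
    move=> j /andP[_ nj0]; rewrite -val_eqE /= in nj0.
    by rewrite (negPf nj0); ring.
  have eqS j : mu1 * (Qcnt x j.+1 ord0)%:R *
      (p * (E (lin a f c (ph x j.+1)) - E L)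
       + (1 - p) * (E (lin a f c (dep1 x j.+1)) - E L)) =
    (Qcnt x j.+1 ord0)%:R * (if j == 0 :> nat then
        mu1 * (p * incr (f - a) + (1 - p) * incr (- a))
      else mu1 * (p * incr (f - a) + (1 - p) * incr (- c))).
    have [->|] := eqVneq (Qcnt x j.+1 ord0) 0%N; first by rewrite !(mulr0, mul0r).
    rewrite -lt0n => Q_gt0; rewrite lin_ph // lin_dep1 // -/L /incr.
    by case: eqP => _; ring.
  rewrite (eq_bigr _ (fun j _ => eqS j)) sum_Qcnt //; ring.
have eqS j : mu2 * (Qcnt x j.+1 ord_max)%:R * (E (lin a f c (dep2 x j.+1)) - E L) =
  (Qcnt x j.+1 ord_max)%:R * (if j == 0 :> nat then mu2 * incr (- f)
                              else mu2 * incr (a - f - c)).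
  have [->|] := eqVneq (Qcnt x j.+1 ord_max) 0%N; first by rewrite !(mulr0, mul0r).
  rewrite -lt0n => Q_gt0; rewrite lin_dep2 // -/L /incr.
  by case: eqP => _; ring.
rewrite (eq_bigr _ (fun j _ => eqS j)) sum_Qcnt //; ring.
Qed.
End Generator.

(** * An exponential Foster-Lyapunov bound *)

(** Global balance multiplied by [g y] and summed; in [gen] the diagonal rates meet a zero
    increment, which matches their exclusion from the balance equations. *)
Lemma stationary_gen (R : realType) (S : finType) (r : S -> S -> R) (pi g : S -> R) :
    (forall y, \sum_(x | x != y) pi x * r x y = pi y * \sum_(z | z != y) r y z) ->
  \sum_x pi x * gen r g x = 0.
Proof.
move=> pi_stat.
have -> : \sum_x pi x * gen r g x =
    \sum_y (\sum_(x | x != y) pi x * r x y) * g y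
    - \sum_x pi x * (\sum_(y | y != x) r x y) * g x.
  under [X in _ = X - _]eq_bigr => y _ do rewrite mulr_suml big_mkcond.
  rewrite exchange_big -sumrB; apply: eq_bigr => x _ /=.
  rewrite /gen -mulrA mulr_suml !mulr_sumr [X in _ = _ - X]big_mkcond -sumrB.
  apply: eq_bigr => y _; rewrite (eq_sym x y).
  by case: eqVneq => [->|_] /=; ring.
by rewrite -sumrB big1 // => y _; rewrite pi_stat subrr.
Qed.

(* Facets more than [tau] below the largest one are negligible in the sum of
   exponentials, so negative drift is only needed on the nearly active ones. *)
Lemma sum_exp_lyapunov (R : realType) (S I : finType) (r : S -> S -> R) (pi : S -> R)
    (ell : I -> S -> R) (K eps tau C : R) :
    (forall x, 0 <= pi x) -> \sum_x pi x = 1 ->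
    (forall y, \sum_(x | x != y) pi x * r x y = pi y * \sum_(z | z != y) r y z) ->
    0 <= K -> 0 < eps -> 0 <= tau ->
    (forall i x, gen r (fun y => expR (ell i y)) x <= K * expR (ell i x)) ->
    (forall i x, (forall j, ell j x <= ell i x + tau) -> C <= ell i x + tau ->
       gen r (fun y => expR (ell i y)) x <= - eps * expR (ell i x)) ->
    2 * #|I|%:R * (K + eps) * expR (- tau) <= eps ->
  \sum_x pi x * \sum_i expR (ell i x) <= 2 * #|I|%:R * (K + eps) / eps * expR C.
Proof.
move=> pi_ge0 pi_sum pi_stat K_ge0 eps_gt0 tau_ge0 gen_le gen_near Ktau.
pose F x := \sum_i expR (ell i x).
pose GF x := \sum_i gen r (fun y => expR (ell i y)) x.
(* Three cases: a nearly maximal, large facet has negative drift; a nearly maximal one below the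
   threshold is bounded through [expR C]; any other is at most [expR (- tau)] times another
   exponential of the sum. *)
have facet_le i x : gen r (fun y => expR (ell i y)) x + eps * expR (ell i x)
    <= (K + eps) * expR (- tau) * F x + (K + eps) * expR C.
  have Ke_ge0 : 0 <= K + eps by lra.
  have F_ge j : expR (ell j x) <= F x.
    by rewrite /F (bigD1 j) //= lerDl sumr_ge0 // => k _; exact: expR_ge0.
  have F_ge0 : 0 <= F x by apply: le_trans (F_ge i); exact: expR_ge0.
  have t1_ge0 : 0 <= (K + eps) * expR (- tau) * F x.
    by rewrite !mulr_ge0 ?expR_ge0.
  have t2_ge0 : 0 <= (K + eps) * expR C by rewrite mulr_ge0 ?expR_ge0.
  have gen_crude : gen r (fun y => expR (ell i y)) x + eps * expR (ell i x)
      <= (K + eps) * expR (ell i x).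
    by rewrite [leRHS]mulrDl lerD2r.
  case: (boolP [forall j, ell j x <= ell i x + tau]) => [/forallP near|].
    have [C_le|C_gt] := leP C (ell i x + tau).
      have := gen_near i x near C_le; lra.
    apply: le_trans gen_crude _.
    suff : (K + eps) * expR (ell i x) <= (K + eps) * expR C by lra.
    by rewrite ler_wpM2l // ler_expR; lra.
  rewrite negb_forall => /existsP[j]; rewrite -ltNge => lt_ij.
  apply: le_trans gen_crude _.
  suff : (K + eps) * expR (ell i x) <= (K + eps) * expR (- tau) * F x by lra.
  rewrite -mulrA ler_wpM2l //.
  apply: le_trans (_ : expR (- tau) * expR (ell j x) <= _).
    by rewrite -expRD ler_expR; lra.
  by rewrite ler_wpM2l ?expR_ge0.
have sum_le x : GF x + eps * F x <= eps / 2 * F x + #|I|%:R * (K + eps) * expR C.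
  have F_ge0 : 0 <= F x by apply: sumr_ge0 => k _; exact: expR_ge0.
  have : GF x + eps * F x <= #|I|%:R * ((K + eps) * expR (- tau) * F x + (K + eps) * expR C).
    rewrite /GF /F mulr_sumr -big_split /=.
    apply: le_trans (ler_sum _ (fun i _ => facet_le i x)) _.
    by rewrite sumr_const mulr_natl.
  have : 2 * #|I|%:R * (K + eps) * expR (- tau) * F x <= eps * F x by rewrite ler_wpM2r.
  lra.
have GF0 : \sum_x pi x * GF x = 0.
  under eq_bigr => x _ do rewrite mulr_sumr.
  by rewrite exchange_big big1 // => i _; exact: stationary_gen.
have : \sum_x pi x * (GF x + eps * F x)
    <= \sum_x pi x * (eps / 2 * F x + #|I|%:R * (K + eps) * expR C).
  by apply: ler_sum => x _; rewrite ler_wpM2l.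
under eq_bigr => x _ do rewrite mulrDr mulrCA.
under [X in _ <= X]eq_bigr => x _ do rewrite mulrDr mulrCA.
rewrite !big_split /= GF0 add0r -!mulr_sumr -mulr_suml pi_sum mul1r.
set EF := \sum_x _ => le_EF.
rewrite -(ler_pM2l eps_gt0); set rhs := leRHS.
have -> : rhs = 2 * (#|I|%:R * (K + eps) * expR C).
  by rewrite /rhs; field; rewrite gt_eqF.
move: le_EF; rewrite /EF /F; lra.
Qed.

(** [1 - y <= expR (- y)] gives [expR y <= 1 / (1 - y)], enough for [x <= 0]. For [x > 0] this is
    too weak, so it is applied to [x / 2] and squared; what remains is [1 - 3 x + x ^ 2 >= 0]. *)
Lemma expR_le_quad (R : realType) (x : R) : x <= 1 / 4 -> expR x <= 1 + x + x ^+ 2.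
Proof.
move=> x_le.
have inv_le (y : R) : y < 1 -> expR y <= (1 - y)^-1.
  move=> y_lt1; rewrite -[y in leLHS]opprK expRN lef_pV2 ?posrE ?expR_gt0 //; last by lra.
  exact: expR_ge1Dx.
have [x_le0|x_gt0] := leP x 0.
  apply: le_trans (inv_le _ _) _; first by lra.
  rewrite -[leLHS]mul1r ler_pdivrMr; last by lra.
  by have := mulr_ge0 (sqr_ge0 x) (_ : 0 <= - x); nra.
have -> : expR x = expR (x / 2) ^+ 2 by rewrite expr2 -expRD; congr expR; field.
have h1 : expR (x / 2) <= (1 - x / 2)^-1 by apply: inv_le; lra.
have h0 := expR_ge0 (x / 2).
have pos : 0 < 1 - x / 2 by lra.
apply: le_trans (_ : (1 - x / 2)^-1 ^+ 2 <= _).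
  by rewrite ler_sqr ?nnegrE // invr_ge0 ltW.
rewrite exprVn -[leLHS]mul1r ler_pdivrMr ?exprn_gt0 //.
have : 0 <= x ^+ 2 * (1 - 3 * x + x ^+ 2) by rewrite mulr_ge0 ?sqr_ge0 //; nra.
by move=> ?; lra.
Qed.

(** * Drift of the facets *)

(* [a1] and [am] are the probabilities that an arriving job joins a busy server,
   respectively a busy server that is not full; [u2] and [v2] are the fractions of
   servers holding at least two jobs, by phase. *)
Record admissible {R : realType} (lam mu1 mu2 p a1 am u v u2 v2 : R) : Prop :=
  Admissible {
    lam_bounds : 0 <= lam <= 1;
    mu1_pos : 0 < mu1; mu2_pos : 0 < mu2; p_bounds : 0 <= p < 1;
    (* the unit mean service time [1 / mu1 + p / mu2 = 1], cleared of fractions *)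
    unit_mean : mu1 * mu2 = mu2 + p * mu1;
    route_bounds : 0 <= am <= a1; a1_bound : a1 <= 1;
    u_bounds : 0 <= u2 <= u; v_bounds : 0 <= v2 <= v; uv_bound : u + v <= 1 }.

Section UnitMean.
Variables (R : realType) (mu1 mu2 p : R).

Lemma mu1_ge1 : 0 < mu1 -> 0 < mu2 -> 0 <= p -> mu1 * mu2 = mu2 + p * mu1 -> 1 <= mu1.
Proof.
move=> mu1_gt0 mu2_gt0 p_ge0 balance; rewrite -(ler_pM2r mu2_gt0) balance.
by have := mulr_ge0 p_ge0 (ltW mu1_gt0); lra.
Qed.

(** The unit mean gives [(1 - p) * mu1 - 1 = (mu1 - 1) * (1 - mu2)]. *)
Lemma phase1_exit_ge1 : 1 <= mu1 -> mu2 <= 1 -> mu1 * mu2 = mu2 + p * mu1 ->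
  1 <= (1 - p) * mu1.
Proof.
move=> mu1ge mu2_le1 balance.
have : 0 <= (mu1 - 1) * (1 - mu2) by rewrite mulr_ge0 // subr_ge0.
lra.
Qed.

End UnitMean.

Section Drift.
Variable R : realType.
Variables lam mu1 mu2 p a1 am u v u2 v2 : R.

(* [flow g a f c] adds [g] of the increment of [a * u + f * v + c * q] (in units of
   [1 / N]) over all transitions, weighted by their rates divided by [N]; [g := id]
   gives the drift and squaring gives the quadratic variation. *)
Definition flow (g : R -> R) (a f c : R) : R :=
  lam * ((1 - a1) * g a + am * g c) + mu1 * p * u * g (f - a)
  + mu1 * (1 - p) * ((u - u2) * g (- a) + u2 * g (- c))
  + mu2 * ((v - v2) * g (- f) + v2 * g (a - f - c)).

Hypothesis adm : admissible lam mu1 mu2 p a1 am u v u2 v2.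

Ltac unpack_admissible :=
  have [/andP[lam_ge0 lam_le1] mu1_gt0 mu2_gt0 /andP[p_ge0 p_lt1] balance
    /andP[am_ge0 am_le_a1] a1_le1 /andP[u2_ge0 u2_le_u] /andP[v2_ge0 v2_le_v] uv_le1] := adm;
  have [mu1_ge0 mu2_ge0] := (ltW mu1_gt0, ltW mu2_gt0).

Local Notation w1 := ((1 - p) * mu1).
Local Notation G := (1 + mu1 + mu2).

Lemma w1_gt0 : 0 < w1.
Proof.
unpack_admissible.
by rewrite mulr_gt0 // subr_gt0.
Qed.

Lemma w1_le_mu1 : w1 <= mu1.
Proof.
unpack_admissible.
by have := mulr_ge0 p_ge0 (ltW mu1_gt0); lra.
Qed.

Lemma flow_le (g h : R -> R) a f c :
    (forall x, x \in [:: a; c; f - a; - a; - c; - f; a - f - c] -> g x <= h x) ->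
  flow g a f c <= flow h a f c.
Proof.
unpack_admissible.
move=> gh.
have gh' x : x \in [:: a; c; f - a; - a; - c; - f; a - f - c] -> 0 <= h x - g x.
  by move=> /gh; rewrite subr_ge0.
rewrite -subr_ge0.
have -> : flow h a f c - flow g a f c = flow (fun x => h x - g x) a f c.
  by rewrite /flow; ring.
have [a1_le u2_le v2_le] : [/\ 0 <= 1 - a1, 0 <= u - u2 & 0 <= v - v2] by split; lra.
have [u_ge0 p_le] : 0 <= u /\ 0 <= 1 - p by split; lra.
have [g1 g2 g3 g4] : [/\ 0 <= h a - g a, 0 <= h c - g c, 0 <= h (f - a) - g (f - a)
    & 0 <= h (- a) - g (- a)] by split; apply: gh'; rewrite !inE eqxx ?orbT.
have [g5 g6 g7] : [/\ 0 <= h (- c) - g (- c), 0 <= h (- f) - g (- f)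
    & 0 <= h (a - f - c) - g (a - f - c)] by split; apply: gh'; rewrite !inE eqxx ?orbT.
rewrite /flow; do 3?[apply: addr_ge0];
  by rewrite !mulr_ge0 // addr_ge0 ?mulr_ge0.
Qed.

(** Arrivals and departures after phase 1 have jumps at most 1. Only jumps involving [f], possibly
    of order [1 / mu2], need [M], weighted by the rates of phase changes and phase 2 completions. *)
Lemma flow_sq_le (M a f c : R) :
    `|a| <= 1 -> `|c| <= 1 -> f ^+ 2 <= M -> (f - a) ^+ 2 <= M ->
    (a - f - c) ^+ 2 <= M ->
  flow (fun x => x ^+ 2) a f c <= 1 + w1 + M * (p * mu1 * u + mu2 * v).
Proof.
unpack_admissible.
move=> a_le c_le f_le fa_le afc_le.
have sq1 (x : R) : `|x| <= 1 -> x ^+ 2 <= 1.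
  by move=> x_le; rewrite -real_normK ?num_real // expr_le1.
have a2 := sq1 _ a_le; have c2 := sq1 _ c_le.
have w1_ge0 := ltW w1_gt0.
have u_ge0 : 0 <= u by lra.
have v_ge0 : 0 <= v by lra.
have h1 : lam * ((1 - a1) * a ^+ 2 + am * c ^+ 2) <= 1.
  apply: mulr_ile1 => //; first by rewrite addr_ge0 // mulr_ge0 ?sqr_ge0 //; lra.
  have : (1 - a1) * a ^+ 2 <= (1 - a1) * 1 by rewrite ler_wpM2l //; lra.
  have : am * c ^+ 2 <= am * 1 by rewrite ler_wpM2l //; lra.
  lra.
have h2 : mu1 * p * u * (f - a) ^+ 2 <= mu1 * p * u * M.
  by rewrite ler_wpM2l // !mulr_ge0.
have h3 : mu1 * (1 - p) * ((u - u2) * (- a) ^+ 2 + u2 * (- c) ^+ 2) <= w1.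
  rewrite !sqrrN [(1 - p) * mu1]mulrC -[leRHS]mulr1 ler_wpM2l //.
    by rewrite mulrC.
  have : (u - u2) * a ^+ 2 <= (u - u2) * 1 by rewrite ler_wpM2l //; lra.
  have : u2 * c ^+ 2 <= u2 * 1 by rewrite ler_wpM2l //; lra.
  lra.
have h4 : mu2 * ((v - v2) * (- f) ^+ 2 + v2 * (a - f - c) ^+ 2) <= mu2 * (v * M).
  rewrite sqrrN ler_wpM2l //.
  have : (v - v2) * f ^+ 2 <= (v - v2) * M by rewrite ler_wpM2l //; lra.
  have : v2 * (a - f - c) ^+ 2 <= v2 * M by rewrite ler_wpM2l //; lra.
  lra.
by rewrite /flow; lra.
Qed.

Lemma flow_sq_le1 a f c :
    `|a| <= 1 -> `|c| <= 1 -> f ^+ 2 <= 1 -> (f - a) ^+ 2 <= 1 ->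
    (a - f - c) ^+ 2 <= 1 -> flow (fun x => x ^+ 2) a f c <= 2 * G.
Proof.
unpack_admissible.
move=> *; apply: le_trans (flow_sq_le 1 a f c _ _ _ _ _) _ => //.
have h1 : p * mu1 * u <= p * mu1 * 1 by rewrite ler_wpM2l ?mulr_ge0 //; lra.
have h2 : mu2 * v <= mu2 * 1 by rewrite ler_wpM2l //; lra.
by lra.
Qed.

(* The factor [p * mu1 * u + mu2 * v <= mu1 * mu2] saves one power of [1 / mu2]. *)
Lemma flow_sq_le_inv a f c : mu2 <= 1 ->
    `|a| <= 1 -> `|c| <= 1 -> f ^+ 2 <= mu2^-1 ^+ 2 -> (f - a) ^+ 2 <= mu2^-1 ^+ 2 ->
    (a - f - c) ^+ 2 <= mu2^-1 ^+ 2 -> flow (fun x => x ^+ 2) a f c <= 2 * G * mu2^-1.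
Proof.
unpack_admissible.
move=> mu2_le1 *; apply: le_trans (flow_sq_le (mu2^-1 ^+ 2) a f c _ _ _ _ _) _ => //.
have m1 := mu1_ge1 R mu1 mu2 p mu1_gt0 mu2_gt0 p_ge0 balance; have w1le := w1_le_mu1.
have h1 : p * mu1 * u + mu2 * v <= mu1 * mu2.
  have : p * mu1 * u <= mu1 * mu2 * u by rewrite ler_wpM2r //; lra.
  have : mu2 * v <= mu1 * mu2 * v.
    by rewrite ler_wpM2r ?ler_peMl //; lra.
  have : mu1 * mu2 * (u + v) <= mu1 * mu2 * 1.
    by rewrite ler_wpM2l // mulr_ge0.
  lra.
have i_ge1 : 1 <= mu2^-1 by rewrite invf_ge1.
have h2 : mu2^-1 ^+ 2 * (p * mu1 * u + mu2 * v) <= mu2^-1 * mu1.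
  apply: le_trans (_ : mu2^-1 ^+ 2 * (mu1 * mu2) <= _).
    by rewrite ler_wpM2l ?sqr_ge0.
  by rewrite le_eqVlt; apply/orP; left; apply/eqP; field; rewrite gt_eqF.
have h3 : (1 + w1) <= (1 + w1) * mu2^-1.
  by rewrite ler_peMr //; have := w1_gt0; lra.
have h4 : (1 + w1 + mu1) * mu2^-1 <= 2 * G * mu2^-1.
  by rewrite ler_wpM2r ?invr_ge0 //; lra.
lra.
Qed.

Lemma driftQ : flow id 0 0 1 = lam * am - w1 * u2 - mu2 * v2.
Proof. by rewrite /flow; ring. Qed.

(** [u + q] counts the jobs that have not finished phase 1: accepted arrivals add one, phase 1
    completions remove one. *)
Lemma driftX_le : flow id 1 0 1 <= lam - mu1 * u.
Proof.
unpack_admissible.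
have : 0 <= lam * (a1 - am) by rewrite mulr_ge0 // subr_ge0.
by rewrite /flow; lra.
Qed.

Lemma driftS_le : flow id 1 1 1 <= lam - w1 * u - mu2 * v.
Proof.
unpack_admissible.
have : 0 <= lam * (a1 - am) by rewrite mulr_ge0 // subr_ge0.
by rewrite /flow; lra.
Qed.

(** A waiting or phase 1 job has mean remaining work 1, a phase 2 job [1 / mu2], so the workload
    drains at rate [u + v]. The bracket multiplied by [k] is the drift of [u + v]. *)
Lemma driftU_le k : flow id (1 - k) (mu2^-1 - k) 1 <=
  lam - u - v - k * (lam * (1 - a1) - w1 * u - mu2 * v + w1 * u2 + mu2 * v2).
Proof.
unpack_admissible.
have : 0 <= lam * (a1 - am) by rewrite mulr_ge0 // subr_ge0.
have e1 : mu1 - p * mu1 * mu2^-1 = 1.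
  by apply: (mulIf (lt0r_neq0 mu2_gt0)); rewrite mulrBl mulfVK ?gt_eqF // balance; ring.
have e2 : mu2 * mu2^-1 = 1 by rewrite mulfV ?gt_eqF.
have -> : flow id (1 - k) (mu2^-1 - k) 1 =
    lam * (1 - a1 + am) - u * (mu1 - p * mu1 * mu2^-1) - mu2 * mu2^-1 * v
    - k * (lam * (1 - a1) - w1 * u - mu2 * v + w1 * u2 + mu2 * v2).
  by rewrite /flow; ring.
by rewrite e1 e2; lra.
Qed.

(** The two terms are the fractions of servers in phases 1 and 2 at fluid equilibrium. *)
Lemma lam_split : lam / mu1 + p * lam / mu2 = lam.
Proof.
unpack_admissible.
have -> : lam / mu1 + p * lam / mu2 = lam * (mu2 + p * mu1) / (mu1 * mu2).
  by field; rewrite !gt_eqF.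
by rewrite -balance mulfK // mulf_neq0 // gt_eqF.
Qed.

(** * Drift of the nearly active facets *)

Variables q d bb c wl : R.
Hypotheses (q_le : q <= bb * (u2 + v2)) (d_gt0 : 0 < d) (bb_gt0 : 0 < bb).
Hypotheses (wl_gt0 : 0 < wl) (wl_le_w1 : wl <= w1) (wl_le_mu2 : wl <= mu2) (c_wl : c * wl = G).
(** The policy bound [1 / sqrt N] is [d / log N] with [d = log N / sqrt N], and [log N >= 56]. *)
Hypothesis few_busy : u + v <= lam + c * d -> a1 <= d / 56.

Local Notation facetQ := (q + (c - 1 / 4) * d).
Local Notation facetX := (u + q - lam / mu1).
Local Notation facetS := (u + v + q - lam).
Local Notation facetW := (u + mu2^-1 * v + q - (lam / mu1 + p * lam / mu2 / mu2)).
Local Notation facetU := (facetW - w1^-1 * (u + v - lam - (G / 4 + w1 / 4) * d)).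

Lemma c_gt0 : 0 < c.
Proof.
unpack_admissible.
have : 0 < c * wl by rewrite c_wl; lra.
by rewrite pmulr_lgt0.
Qed.

(** The first hypothesis says [u + v <= lam + c d], hence [a1 <= d / 56]. The second gives
    [q >= bb c d / 2], hence [u2 + v2 >= c d / 2], so the queues drain at rate at least
    [wl c d / 2 = G d / 2]. *)
Lemma driftQ_near :
    facetS <= facetQ + d / 4 -> (c + bb * c / 2) * d <= facetQ + d / 4 ->
  flow id 0 0 1 <= - (G / 4) * d.
Proof.
unpack_admissible.
have dgt := d_gt0; have bgt := bb_gt0; have wlgt := wl_gt0; have qle := q_le.
move=> S_le Q_ge; have cgt := c_gt0.
have a1_le : a1 <= d / 56 by apply: few_busy; lra.
have uv2_ge : c * d / 2 <= u2 + v2.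
  by rewrite -(ler_pM2l bgt); apply: le_trans qle; lra.
have work_ge : wl * (c * d / 2) <= w1 * u2 + mu2 * v2.
  apply: le_trans (_ : wl * (u2 + v2) <= _); first by rewrite ler_pM2l.
  by rewrite mulrDr lerD // ler_wpM2r.
have wlc : wl * (c * d / 2) = G * d / 2 by rewrite -c_wl; ring.
have lam_am : lam * am <= am by rewrite ler_piMl.
have Gd : d <= G * d by rewrite ler_peMl //; lra.
by rewrite driftQ; lra.
Qed.

(** [q] cancels and leaves [u - lam / mu1 >= (c - 1 / 2) d]; moreover [mu1 c >= G], because
    [mu1 >= w1 >= wl]. *)
Lemma driftX_near : facetQ <= facetX + d / 4 -> flow id 1 0 1 <= - (G / 4) * d.
Proof.
unpack_admissible.
move=> Q_le; have cgt := c_gt0; have dgt := d_gt0.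
apply: le_trans driftX_le _.
have -> : lam - mu1 * u = - (mu1 * (u - lam / mu1)) by field; rewrite gt_eqF.
have x_ge : (c - 1 / 2) * d <= u - lam / mu1 by lra.
move: (u - lam / mu1) x_ge => x x_ge.
have mx : mu1 * ((c - 1 / 2) * d) <= mu1 * x by rewrite ler_pM2l.
have mu1c : G <= mu1 * c.
  rewrite -c_wl mulrC ler_pM2r //.
  by apply: le_trans wl_le_w1 _; exact: w1_le_mu1.
have : G * d <= mu1 * c * d by rewrite ler_pM2r.
have : 0 <= mu2 * d by rewrite mulr_ge0 // ltW.
have : 0 <= mu1 * d by rewrite mulr_ge0 // ltW.
lra.
Qed.

(** [facetQ] yields [u + v - lam >= (c - 1 / 2) d] and [facetX] yields [v >= p lam / mu2 - d / 4];
    the excess service rate is [w1 (u + v - lam) + (mu2 - w1) (v - p lam / mu2)]. *)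
Lemma driftS_near : w1 <= mu2 -> wl = w1 ->
    facetQ <= facetS + d / 4 -> facetX <= facetS + d / 4 ->
  flow id 1 1 1 <= - (G / 4) * d.
Proof.
unpack_admissible.
move=> w1_le wlE Q_le X_le; have cgt := c_gt0; have dgt := d_gt0; have w1gt := w1_gt0.
apply: le_trans driftS_le _.
have lamE := lam_split.
have workE : w1 * (lam / mu1) + mu2 * (p * lam / mu2) = lam.
  by field; rewrite !gt_eqF.
move: (lam / mu1) (p * lam / mu2) lamE workE X_le => x0 y0 lamE workE X_le.
have z_ge : w1 * ((c - 1 / 2) * d) <= w1 * (u + v - lam) by rewrite ler_pM2l //; lra.
have y_ge : (mu2 - w1) * (- (d / 4)) <= (mu2 - w1) * (v - y0).
  by rewrite ler_wpM2l ?subr_ge0 //; lra.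
have cw1 : w1 * c * d = G * d by rewrite -c_wl wlE; ring.
have w1le : w1 * d <= mu1 * d by rewrite ler_pM2r // w1_le_mu1.
have : 0 <= mu2 * d by rewrite mulr_ge0 // ltW.
have : 0 <= mu1 * d by rewrite mulr_ge0 // ltW.
have -> : lam - w1 * u - mu2 * v = - (w1 * (u + v - lam)) - (mu2 - w1) * (v - y0).
  by rewrite -{1}workE -lamE; ring.
lra.
Qed.

(** The hypothesis means [u + v - lam >= (G / 4) d], exactly the drift wanted; this dictates the
    constant [G / 4 + w1 / 4] in [facetU]. *)
Lemma driftW_near : facetU <= facetW + d / 4 -> flow id 1 mu2^-1 1 <= - (G / 4) * d.
Proof.
unpack_admissible.
have w1gt := w1_gt0; move=> U_le.
have := driftU_le 0; rewrite !subr0 mul0r => /le_trans; apply.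
have : w1 * (w1^-1 * (u + v - lam - (G / 4 + w1 / 4) * d)) >= w1 * (- (d / 4)).
  by rewrite ler_pM2l //; lra.
by rewrite mulVKf ?gt_eqF //; lra.
Qed.

(** [facetW] bounds [z = u + v - lam] from above, so few arrivals join busy servers; [facetQ] then
    forces a surplus [y] in the slower phase 2, which makes [u + v] grow. The weight [1 / w1] makes
    the [z] terms of this growth and of the workload drift cancel. *)
Lemma driftU_near : mu2 <= 1 -> wl = mu2 ->
    facetQ <= facetU + d / 4 -> facetW <= facetU + d / 4 ->
  flow id (1 - w1^-1) (mu2^-1 - w1^-1) 1 <= - (G / 4) * d.
Proof.
unpack_admissible.
move=> mu2_le1 wlE Q_le W_le.
have cgt := c_gt0; have dgt := d_gt0; have w1gt := w1_gt0.
have mu1ge := mu1_ge1 R mu1 mu2 p mu1_gt0 mu2_gt0 p_ge0 balance.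
have w1ge := phase1_exit_ge1 R mu1 mu2 p mu1ge mu2_le1 balance.
have w1le := w1_le_mu1.
apply: le_trans (driftU_le _) _.
have lamE := lam_split.
have workE : w1 * (lam / mu1) + mu2 * (p * lam / mu2) = lam.
  by field; rewrite !gt_eqF.
pose k := w1^-1; pose y := v - p * lam / mu2; pose Y := mu2^-1 * y.
rewrite -/k in Q_le W_le *.
have k_w1 : k * w1 = 1 by rewrite mulVf ?gt_eqF.
have k_gt0 : 0 < k by rewrite invr_gt0.
have k_le1 : k <= 1 by rewrite invf_le1.
have muY : mu2 * Y = y by rewrite mulVKf ?gt_eqF.
have WE : facetW = u + q - lam / mu1 + Y by rewrite /Y /y; ring.
rewrite {}WE in Q_le W_le.
pose z := u + v - lam.
have zE : u - lam / mu1 = z - y by rewrite /z /y -[X in _ = _ + _ - X - _]lamE; ring.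
have W_le' : w1 * (k * (z - (G / 4 + w1 / 4) * d)) <= w1 * (d / 4).
  by rewrite ler_pM2l // /z; lra.
rewrite mulrA [w1 * k]mulrC k_w1 mul1r in W_le'.
have cmu2 : c * mu2 = G by rewrite -c_wl wlE.
have G_le_c : G <= c by rewrite -cmu2 ler_piMr // ltW.
have a1_le : a1 <= d / 56.
  apply: few_busy; rewrite -lerBlDl -/z.
  have : G * d <= c * d by rewrite ler_pM2r.
  have : w1 * d <= G * d by rewrite ler_pM2r //; lra.
  have : 0 <= G * d by rewrite mulr_ge0 ?ltW //; lra.
  lra.
have z1k : (1 - k) * z <= (1 - k) * ((G / 4 + w1 / 2) * d).
  by rewrite ler_wpM2l ?subr_ge0 //; lra.
have Y_ge : (c - 1 / 4 - G / 4 - w1 / 2) * d <= (1 - mu2) * Y.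
  have kw1d : k * w1 * d = d by rewrite k_w1 mul1r.
  have -> : (1 - mu2) * Y = Y - y by rewrite -muY; ring.
  have : (c - 1 / 4) * d <= z - y + Y - k * (z - (G / 4 + w1 / 4) * d) + d / 4.
    by rewrite -zE /z; lra.
  lra.
have mm_ge0 : 0 <= mu1 * mu2 by rewrite mulr_ge0.
have y_ge : mu1 * (mu2 * ((c - 1 / 4 - G / 4 - w1 / 2) * d)) <= (w1 - mu2) * y.
  have -> : (w1 - mu2) * y = mu1 * mu2 * ((1 - mu2) * Y).
    rewrite -muY; have -> : w1 - mu2 = mu1 * (1 - mu2) by lra.
    by ring.
  by rewrite mulrA ler_wpM2l.
(* From [c * mu2 = G] and [mu2 <= 1]; the extra [1 / 56] pays for the loss [lam * a1] in [main]. *)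
have bracket : (G / 4 + 1 / 56) * d <= mu2 * ((c - 1 / 4 - G / 4 - w1 / 2) * d).
  rewrite mulrA ler_pM2r //.
  have : mu2 * (1 / 4 + G / 4 + w1 / 2) <= 1 * (1 / 4 + G / 4 + w1 / 2).
    by rewrite ler_wpM2r //; lra.
  lra.
have mbracket : w1 * (G / 4 * d) + d / 56 <= (w1 - mu2) * y.
  apply: le_trans y_ge; apply: le_trans (_ : mu1 * ((G / 4 + 1 / 56) * d) <= _); last first.
    by rewrite ler_pM2l.
  have : w1 * (G / 4 * d) <= mu1 * (G / 4 * d).
    by rewrite ler_wpM2r // mulr_ge0 ?ltW //; lra.
  have : 1 * (d / 56) <= mu1 * (d / 56) by rewrite ler_wpM2r //; lra.
  lra.
have main : lam * (1 - a1) - w1 * u - mu2 * v + w1 * u2 + mu2 * v2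
    >= - (w1 * z) + (w1 * (G / 4 * d)).
  have w1u2 : 0 <= w1 * u2 by rewrite mulr_ge0 // ltW.
  have mu2v2 : 0 <= mu2 * v2 by rewrite mulr_ge0.
  have lama1 : lam * a1 <= a1 by rewrite ler_piMl //; lra.
  have workz : lam - w1 * u - mu2 * v = - (w1 * z) + (w1 - mu2) * y.
    have -> : lam - w1 * u - mu2 * v = - (w1 * (u - lam / mu1)) - mu2 * y.
      by rewrite -{1}workE /y; ring.
    by rewrite zE; ring.
  lra.
have : k * (- (w1 * z) + (w1 * (G / 4 * d)))
    <= k * (lam * (1 - a1) - w1 * u - mu2 * v + w1 * u2 + mu2 * v2) by rewrite ler_pM2l.
have -> : k * (- (w1 * z) + (w1 * (G / 4 * d))) = k * w1 * (- z + G / 4 * d) by ring.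
by rewrite k_w1 /z; lra.
Qed.

(** * Drift bounds valid in every state *)

Lemma driftQ_le1 : flow id 0 0 1 <= 1.
Proof.
unpack_admissible.
have : lam * am <= 1 by apply: mulr_ile1 => //; lra.
have : 0 <= w1 * u2 by rewrite mulr_ge0 // ltW // w1_gt0.
have : 0 <= mu2 * v2 by rewrite mulr_ge0.
by rewrite driftQ; lra.
Qed.

Lemma driftX_le1 : flow id 1 0 1 <= 1.
Proof.
unpack_admissible.
apply: le_trans driftX_le _.
have : 0 <= mu1 * u by rewrite mulr_ge0 //; lra.
lra.
Qed.

Lemma driftS_le1 : flow id 1 1 1 <= 1.
Proof.
unpack_admissible.
apply: le_trans driftS_le _.
have : 0 <= w1 * u by rewrite mulr_ge0 ?(ltW w1_gt0) //; lra.
have : 0 <= mu2 * v by rewrite mulr_ge0 //; lra.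
lra.
Qed.

Lemma driftU_le1 k : 0 <= k -> k * w1 <= 1 -> k * mu2 <= 1 ->
  flow id (1 - k) (mu2^-1 - k) 1 <= 1.
Proof.
unpack_admissible.
move=> k_ge0 kw1 kmu2; apply: le_trans (driftU_le _) _.
have : 0 <= k * (lam * (1 - a1)) by rewrite !mulr_ge0 // subr_ge0.
have : 0 <= k * (w1 * u2) by rewrite !mulr_ge0 // subr_ge0 ltW.
have : 0 <= k * (mu2 * v2) by rewrite !mulr_ge0.
have : k * w1 * u <= 1 * u by rewrite ler_wpM2r //; lra.
have : k * mu2 * v <= 1 * v by rewrite ler_wpM2r //; lra.
lra.
Qed.

End Drift.

(** * Server fractions *)

Section Fractions.
Variables (R : realType) (N b : nat).
Implicit Types x : state N b.

Definition share x (l : nat) (m : 'I_2) : R := (lvl x l m)%:R / N%:R.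
Definition queue x : R := sumS x - s1 x.

Hypotheses (N_gt0 : (0 < N)%N) (b_gt0 : (0 < b)%N).

Let NR_gt0 : 0 < N%:R :> R.
Proof. by rewrite ltr0n. Qed.

Lemma s1E x : s1 x = share x 1 ord0 + share x 1 ord_max.
Proof. by rewrite /s1 natrD mulrDl. Qed.

Lemma queueE x : queue x =
  \sum_(i < b | (0 < i)%N) (share x i.+1 ord0 + share x i.+1 ord_max).
Proof.
rewrite /queue /sumS (bigD1 (Ordinal b_gt0)) //= s1E -!lvl_ord mulrDl addrAC subrr add0r.
apply: eq_big => [i|i _]; first by rewrite -val_eqE /= lt0n.
by rewrite -!lvl_ord mulrDl.
Qed.

Lemma lin_share a f c x : lin R b a f c (cnt x) =
  N%:R * (a * share x 1 ord0 + f * share x 1 ord_max + c * queue x).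
Proof.
rewrite queueE /lin (bigD1 (Ordinal b_gt0)) //= -!lvl_ord /= !mulrDr !mulr_sumr.
have N_neq0 := lt0r_neq0 NR_gt0.
congr (_ + _); first by rewrite /share; field.
apply: eq_big => [i|i]; first by rewrite -val_eqE /= lt0n.
rewrite -val_eqE /= => /negPf ->; rewrite -!lvl_ord /share; field.
exact: N_neq0.
Qed.

Lemma share_ge0 x l m : 0 <= share x l m.
Proof. by rewrite divr_ge0. Qed.

Lemma share_noninc x l l' m : (0 < l)%N -> (l <= l')%N -> share x l' m <= share x l m.
Proof. by move=> *; rewrite ler_pM2r ?invr_gt0 // ler_nat lvl_noninc. Qed.

Lemma queue_le x : queue x <= b%:R * (share x 2 ord0 + share x 2 ord_max).
Proof.
rewrite queueE mulrC mulr_natr -[b in _ *+ b]card_ord -sumr_const big_mkcond /=.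
apply: ler_sum => i _; case: ifP => [i_gt0|_]; first by rewrite lerD // share_noninc.
by rewrite addr_ge0 ?share_ge0.
Qed.

Lemma share_le1 x : share x 1 ord0 + share x 1 ord_max <= 1.
Proof. by rewrite -s1E ler_pdivrMr // mul1r ler_nat lvl_le_N. Qed.

Lemma A1_bounds (A : policy N b R) x : valid_policy A -> 0 <= A1 A x <= 1.
Proof.
move=> /(_ x)[A_ge0 [<- _]].
rewrite sumr_ge0 => [/=|j _]; last by rewrite sumr_ge0.
rewrite [leRHS](bigID (fun j : 'I_b.+1 => (0 < j)%N)) /= lerDl sumr_ge0 // => j _.
by rewrite sumr_ge0.
Qed.

Lemma share_admissible (lam mu1 mu2 p : R) (A : policy N b R) x am :
    0 <= lam <= 1 -> 0 < mu1 -> 0 < mu2 -> 0 <= p < 1 ->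
    mu1 * mu2 = mu2 + p * mu1 -> valid_policy A -> 0 <= am <= A1 A x ->
  admissible lam mu1 mu2 p (A1 A x) am (share x 1 ord0) (share x 1 ord_max)
    (share x 2 ord0) (share x 2 ord_max).
Proof.
move=> ? ? ? ? ? A_valid ?; have /andP[_ A1_le1] := A1_bounds A x A_valid.
by split=> //; rewrite ?share_ge0 ?share_noninc ?share_le1.
Qed.

(** [expR_le_quad] at each jump: the linear part gives the drift, the square the quadratic
    variation. *)
Lemma gen_exp_le (lam mu1 mu2 p : R) (A : policy N b R) x (a f c theta s : R) :
    0 <= lam <= 1 -> 0 < mu1 -> 0 < mu2 -> 0 <= p < 1 ->
    mu1 * mu2 = mu2 + p * mu1 -> valid_policy A -> 0 <= theta ->
    (forall y, y \in [:: a; c; f - a; - a; - c; - f; a - f - c] -> theta * y <= 1 / 4) ->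
  exists2 am, 0 <= am <= A1 A x &
  let fl g := flow R lam mu1 mu2 p (A1 A x) am (share x 1 ord0) (share x 1 ord_max)
      (share x 2 ord0) (share x 2 ord_max) g a f c in
  gen (rate lam mu1 mu2 p A) (fun y => expR (theta * lin R b a f c (cnt y) + s)) x
    <= N%:R * theta * (fl id + theta * fl (fun y => y ^+ 2))
       * expR (theta * lin R b a f c (cnt x) + s).
Proof.
move=> lamP mu1P mu2P pP bal A_valid theta_ge0 jumps.
have [am amP genE] := gen_lin R N b lam mu1 mu2 p A x (fun y => expR (theta * y + s))
  a f c b_gt0 A_valid.
exists am => // fl; rewrite genE.
set L := lin _ _ _ _ _ _; set e := expR (theta * L + s).
pose incr d := expR (theta * (L + d) + s) - e.
have N_neq0 := lt0r_neq0 NR_gt0.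
have adm := share_admissible lam mu1 mu2 p A x am lamP mu1P mu2P pP bal A_valid amP.
apply: le_trans (_ : N%:R * fl incr <= _).
  by rewrite le_eqVlt /fl /flow /incr /share -/e; apply/orP; left; apply/eqP; field.
have -> : N%:R * theta * (fl id + theta * fl (fun y => y ^+ 2)) * e =
    N%:R * fl (fun y => e * (theta * y + (theta * y) ^+ 2)).
  by rewrite /fl /flow; ring.
rewrite ler_pM2l //; apply: (flow_le _ _ _ _ _ _ _ _ _ _ _ adm) => y /jumps y_le.
rewrite /incr.
have -> : theta * (L + y) + s = (theta * L + s) + theta * y by ring.
rewrite expRD -/e -subr_ge0.
have -> : e * (theta * y + (theta * y) ^+ 2) - (e * expR (theta * y) - e) =
  e * (1 + theta * y + (theta * y) ^+ 2 - expR (theta * y)) by ring.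
by rewrite mulr_ge0 ?expR_ge0 // subr_ge0 expR_le_quad.
Qed.

End Fractions.
Arguments share {R N b}.
Arguments queue {R N b}.

(** * From facets to the expected excess *)

(** The choice of [theta] makes the second-order term at most [theta * 2 G B = G d / 8], half of the
    negative drift, and keeps [theta] times each jump below [1 / 4]. The positive part is controlled
    by [y <= expR (M y) / M] with [M = N theta]. *)
Lemma excess_le_of_facets (R : realType) (N b : nat) (lam mu1 mu2 p : R)
    (A : policy N b R) (pi : state N b -> R) (I : finType) (fa ff fc fk : I -> R)
    (d B C k : R) :
  let G := 1 + mu1 + mu2 in
  let theta := d / (16 * B) in
  let value i x := fa i * share x 1 ord0 + ff i * share x 1 ord_max
                   + fc i * queue x + fk i in
  let fl x am g i := flow R lam mu1 mu2 p (A1 A x) am (share x 1 ord0)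
    (share x 1 ord_max) (share x 2 ord0) (share x 2 ord_max)
    g (fa i) (ff i) (fc i) in
    (0 < N)%N -> (0 < b)%N -> #|I| = 4%N -> 0 <= lam <= 1 -> 0 < mu1 -> 0 < mu2 ->
    0 <= p < 1 -> mu1 * mu2 = mu2 + p * mu1 -> valid_policy A ->
    stationary lam mu1 mu2 p A pi -> 0 < d <= 1 -> 1 <= B ->
    (forall i y, y \in [:: fa i; ff i; fc i; ff i - fa i; fa i - ff i - fc i] ->
       `|y| <= B) ->
    (forall x am i, 0 <= am <= A1 A x ->
       fl x am (fun y => y ^+ 2) i <= 2 * G * B /\ fl x am id i <= 1) ->
    (forall x am i, 0 <= am <= A1 A x ->
       (forall j, value j x <= value i x + d / 4) -> C * d <= value i x + d / 4 ->
       fl x am id i <= - (G / 4) * d) ->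
    (forall x, exists i, sumS x - lam <= value i x) ->
    64 * (1 + G * d / 4) * expR (- (N%:R * theta * d / 4)) <= G * d ->
  \sum_x pi x * Num.max (sumS x - lam - k * d) 0 <=
    64 * (1 + G * d / 4) / (G * d) / (N%:R * theta) * expR (N%:R * theta * (C - k) * d).
Proof.
move=> G theta value fl N_gt0 b_gt0 cardI lamP mu1P mu2P pP bal A_valid
  [pi_ge0 [pi_sum pi_stat]] /andP[d_gt0 d_le1] B_ge1 coef_le fl_le fl_near cover small.
have B_gt0 : 0 < B by apply: lt_le_trans B_ge1.
have theta_gt0 : 0 < theta by rewrite divr_gt0 // mulr_gt0.
have thetaB : theta * B = d / 16 by rewrite /theta; field; rewrite gt_eqF.
have G_gt0 : 0 < G by rewrite /G; lra.
have NR_gt0 : 0 < N%:R :> R by rewrite ltr0n.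
set M := N%:R * theta in small *.
have M_gt0 : 0 < M by rewrite mulr_gt0.
pose ell i (x : state N b) := theta * lin R b (fa i) (ff i) (fc i) (cnt x) + M * fk i.
have ellE i x : ell i x = M * value i x.
  by rewrite /ell lin_share // /M /value; ring.
have Gd_gt0 : 0 < G * d by rewrite mulr_gt0.
have gen_bound i x : exists2 am, 0 <= am <= A1 A x &
    gen (rate lam mu1 mu2 p A) (fun y => expR (ell i y)) x
      <= M * (fl x am id i + G * d / 8) * expR (ell i x).
  have [y jump|am amP gen_le] := gen_exp_le R N b N_gt0 b_gt0 lam mu1 mu2 p A x
    (fa i) (ff i) (fc i) theta (M * fk i) lamP mu1P mu2P pP bal A_valid (ltW theta_gt0).
    have y_le : `|y| <= B.
      by move: jump; rewrite !inE; do 6?[case/orP]; move=> /eqP ->;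
        rewrite ?normrN (coef_le i) // !inE eqxx ?orbT.
    apply: le_trans (_ : theta * B <= _); last by rewrite thetaB; lra.
    by rewrite ler_pM2l // (le_trans (ler_norm _)).
  exists am => //; apply: le_trans gen_le _.
  rewrite ler_wpM2r ?expR_ge0 // ler_pM2l // lerD2l -/(fl x am (fun y => y ^+ 2) i).
  have [sq_le _] := fl_le x am i amP.
  apply: le_trans (_ : theta * (2 * G * B) <= _); first by rewrite ler_pM2l.
  have -> : theta * (2 * G * B) = 2 * G * (theta * B) by ring.
  by rewrite thetaB; lra.
pose K := M * (1 + G * d / 8); pose eps := M * (G * d / 8).
have eps_gt0 : 0 < eps by rewrite mulr_gt0 // divr_gt0.
have K_ge0 : 0 <= K by rewrite mulr_ge0 ?(ltW M_gt0) //; lra.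
have KE : K + eps = M * (1 + G * d / 4) by rewrite /K /eps; field.
have EF : \sum_x pi x * \sum_i expR (ell i x) <=
    2 * #|I|%:R * (K + eps) / eps * expR (M * (C * d)).
  apply: (sum_exp_lyapunov _ _ _ (rate lam mu1 mu2 p A) _ _ _ _ (M * d / 4)) => //.
  - by rewrite divr_ge0 // mulr_ge0 ?ltW.
  - move=> i x; have [am amP] := gen_bound i x; move/le_trans; apply.
    rewrite ler_wpM2r ?expR_ge0 // ler_pM2l //.
    by have [_] := fl_le x am i amP; lra.
  - move=> i x near C_le; have [am amP] := gen_bound i x; move/le_trans; apply.
    rewrite ler_wpM2r ?expR_ge0 // /eps -mulrN ler_pM2l //.
    have : fl x am id i <= - (G / 4) * d.
      apply: fl_near => // [j|].
        have := near j; rewrite !ellE -mulrA -[leRHS]mulrDr => le_ji.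
        by rewrite ler_pM2l in le_ji.
      move: C_le; rewrite ellE -mulrA -[leRHS]mulrDr => C_le.
      by rewrite ler_pM2l in C_le.
    lra.
  rewrite cardI KE /eps.
  have -> : 2 * 4%:R * (M * (1 + G * d / 4)) * expR (- (M * d / 4)) =
    M / 8 * (64 * (1 + G * d / 4) * expR (- (M * d / 4))) by field.
  have -> : M * (G * d / 8) = M / 8 * (G * d) by field.
  by rewrite ler_pM2l // divr_gt0.
have excess_le x : Num.max (sumS x - lam - k * d) 0 <=
    M^-1 * expR (- (M * (k * d))) * \sum_i expR (ell i x).
  have [i i_cover] := cover x.
  have F_ge : expR (M * (sumS x - lam)) <= \sum_i expR (ell i x).
    apply: le_trans (_ : expR (ell i x) <= _).
      by rewrite ler_expR ellE ler_pM2l.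
    by rewrite [leRHS](bigD1 i) //= lerDl sumr_ge0 // => j _; exact: expR_ge0.
  have F_ge0 := le_trans (expR_ge0 _) F_ge.
  rewrite ge_max mulr_ge0 ?mulr_ge0 ?expR_ge0 ?invr_ge0 ?(ltW M_gt0) // andbT.
  rewrite -mulrA ler_pdivlMl //.
  apply: le_trans (_ : expR (- (M * (k * d))) * expR (M * (sumS x - lam)) <= _); last first.
    by rewrite ler_wpM2l ?expR_ge0.
  rewrite -expRD; set y := leLHS.
  have -> : - (M * (k * d)) + M * (sumS x - lam) = y by rewrite /y; ring.
  by have := expR_ge1Dx y; lra.
apply: le_trans (ler_sum _ (fun x _ => ler_wpM2l (pi_ge0 x) (excess_le x))) _.
under eq_bigr => x _ do rewrite mulrCA.
rewrite -mulr_sumr.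
apply: le_trans (ler_wpM2l _ EF) _.
  by rewrite mulr_ge0 ?expR_ge0 // invr_ge0 ltW.
have -> : M * (C - k) * d = - (M * (k * d)) + M * (C * d) by ring.
rewrite expRD KE cardI /eps le_eqVlt; apply/orP; left; apply/eqP; field.
by rewrite !gt_eqF.
Qed.

(** Here [n = sqrt N] and [L = log N]. The exponent [N theta d] equals [L ^ 2 / (16 B)], at least
    [7 / 2 * L] since [56 * B <= L]. *)
Lemma facet_constants (R : realType) (N : nat) (n L B G Ck : R) :
    n ^+ 2 = N%:R -> expR (L / 2) = n -> 1 <= B -> 56 * B <= L -> 1 <= G ->
    4 <= Ck ->
  let d := L / n in
  let theta := d / (16 * B) in
  64 * (1 + G * d / 4) * expR (- (N%:R * theta * d / 4)) <= G * d /\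
  64 * (1 + G * d / 4) / (G * d) / (N%:R * theta) * expR (N%:R * theta * - Ck * d)
    <= 7 / (n * L).
Proof.
move=> n2 nE B_ge1 LB G_ge1 Ck_ge4 d theta.
have L_ge : 56 <= L by lra.
have L_gt0 : 0 < L by lra.
have n_ge : 1 + L / 2 <= n by rewrite -nE expR_ge1Dx.
have n_gt0 : 0 < n by lra.
have B_gt0 : 0 < B by lra.
have d_gt0 : 0 < d by rewrite divr_gt0.
have d_le : d <= G * d by rewrite ler_peMl // ltW.
have Gd_gt0 : 0 < G * d by lra.
pose s := L ^+ 2 / (16 * B).
have sE : N%:R * theta * d = s.
  by rewrite /theta /s /d -n2; field; rewrite !gt_eqF.
have s_ge : 7 / 2 * L <= s.
  rewrite /s ler_pdivlMr ?mulr_gt0 //.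
  have : 56 * B * L <= L * L by rewrite ler_pM2r.
  by rewrite expr2; lra.
split.
  rewrite sE.
  (* [7 / 8 = 1 / 2 + 3 / 8]: the first part gives [1 / n], the second at most [1 / 22], as
     [3 / 8 * 56 = 21]. *)
  have e_le : expR (- (s / 4)) <= n^-1 * 22^-1.
    apply: le_trans (_ : expR (- (L / 2)) * expR (- (3 / 8 * L)) <= _).
      by rewrite -expRD ler_expR; lra.
    rewrite expRN nE ler_pM2l ?invr_gt0 // expRN lef_pV2 ?posrE ?expR_gt0 //.
    by apply: le_trans (expR_ge1Dx _); lra.
  have n1_gt0 : 0 < n^-1 by rewrite invr_gt0.
  have n1_le : n^-1 <= 29^-1 by rewrite lef_pV2 ?posrE //; lra.
  have dE : d = L * n^-1 by [].
  apply: le_trans (_ : 64 * (1 + G * d / 4) * (n^-1 * 22^-1) <= _).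
    by rewrite ler_wpM2l //; lra.
  have : 56 * n^-1 <= L * n^-1 by rewrite ler_pM2r.
  have : G * d * n^-1 <= G * d * 29^-1 by rewrite ler_pM2l.
  move: n1_gt0 d_le Gd_gt0; rewrite dE.
  move: (n^-1) => m; move: (G * (L * m)) => Gd.
  lra.
have -> : N%:R * theta * - Ck * d = - (Ck * s) by rewrite -sE; ring.
(* [Ck * s >= 14 * L]: one [expR (- L)] absorbs the growth of the prefactor, at most [24 * expR L];
   the rest beats 24. *)
have e_le : expR (- (Ck * s)) <= expR (- (13 * L)) * expR (- L).
  rewrite -expRD ler_expR.
  have : 4 * s <= Ck * s by rewrite ler_pM2r //; lra.
  lra.
have -> : 64 * (1 + G * d / 4) / (G * d) / (N%:R * theta) =
    1024 * B * ((G * d)^-1 + 1 / 4) * (n * L)^-1.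
  by rewrite /theta -n2 /d; field; rewrite !gt_eqF //; lra.
rewrite mulrAC ler_pM2r ?invr_gt0 ?mulr_gt0 //.
have Gd_inv : (G * d)^-1 <= n / L.
  by rewrite -[n / L]invf_div lef_pV2 ?posrE ?divr_gt0.
have n_le : n <= expR L by rewrite -nE ler_expR; lra.
have L_le : L <= expR L by have := expR_ge1Dx L; lra.
have e1 : expR L * expR (- L) = 1 by rewrite -expRD subrr expR0.
have e13 : expR (- (13 * L)) <= 24^-1.
  rewrite expRN lef_pV2 ?posrE ?expR_gt0 //.
  by apply: le_trans (expR_ge1Dx _); lra.
have e13_ge0 := expR_ge0 (- (13 * L)).
have factor_le : 1024 * B * ((G * d)^-1 + 1 / 4) <= 24 * expR L.
  apply: le_trans (_ : 1024 * B * (n / L + 1 / 4) <= _).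
    by rewrite ler_pM2l ?mulr_gt0 // lerD2r.
  apply: le_trans (_ : 1024 / 56 * L * (n / L + 1 / 4) <= _).
    rewrite ler_pM2r; first by lra.
    by rewrite addr_gt0 // divr_gt0.
  have -> : 1024 / 56 * L * (n / L + 1 / 4) = 1024 / 56 * (n + L / 4).
    by field; rewrite gt_eqF.
  lra.
apply: le_trans (_ : 24 * expR L * (expR (- (13 * L)) * expR (- L)) <= _).
  apply: ler_pM; rewrite ?expR_ge0 //.
  have : 0 <= (G * d)^-1 by rewrite invr_ge0 ltW.
  by move=> ?; apply: mulr_ge0; lra.
have -> : 24 * expR L * (expR (- (13 * L)) * expR (- L)) = 24 * expR (- (13 * L)).
  by rewrite -[RHS]mulr1 -e1; ring.
lra.
Qed.

Lemma excess_le (R : realType) (N b : nat) (lam mu1 mu2 p d n L c wl k : R)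
    (A : policy N b R) (pi : state N b -> R) :
    (0 < N)%N -> (0 < b)%N -> 0 <= lam <= 1 -> 0 < mu1 -> 0 < mu2 -> 0 <= p < 1 ->
    mu1 * mu2 = mu2 + p * mu1 -> valid_policy A -> stationary lam mu1 mu2 p A pi ->
    n ^+ 2 = N%:R -> expR (L / 2) = n -> d = L / n -> 0 < d <= 1 ->
    56 <= L -> 56 <= L * mu2 ->
    wl = Num.min ((1 - p) * mu1) mu2 -> c * wl = 1 + mu1 + mu2 ->
    (forall x, s1 x <= lam + c * d -> A1 A x <= d / 56) ->
    c + b%:R * c / 2 + 4 <= k ->
  \sum_x pi x * Num.max (sumS x - lam - k * d) 0 <= 7 / (n * L).
Proof.
move=> N_gt0 b_gt0 lamP mu1P mu2P pP bal A_valid pi_stat n2 nE dE dP L_ge Lmu2 wlE c_wl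
  few k_ge.
have /andP[p_ge0 p_lt1] := pP; have /andP[d_gt0 d_le1] := dP.
have mu1ge := mu1_ge1 R mu1 mu2 p mu1P mu2P p_ge0 bal.
have w1_gt0 : 0 < (1 - p) * mu1 by rewrite mulr_gt0 // subr_gt0.
have wl_gt0 : 0 < wl by rewrite wlE lt_min w1_gt0.
have wl_le_w1 : wl <= (1 - p) * mu1 by rewrite wlE ge_min lexx.
have wl_le_mu2 : wl <= mu2 by rewrite wlE ge_min lexx orbT.
have G_ge1 : 1 <= 1 + mu1 + mu2 by lra.
have bR_gt0 : 0 < b%:R :> R by rewrite ltr0n.
have adm x am (amP : 0 <= am <= A1 A x) :=
  share_admissible R N b N_gt0 lam mu1 mu2 p A x am lamP mu1P mu2P pP bal A_valid amP.
have sumSE (x : state N b) : sumS x = share x 1 ord0 + share x 1 ord_max + queue x :> R.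
  by rewrite -s1E /queue addrC subrK.
have q_le (x : state N b) := queue_le R N b N_gt0 b_gt0 x.
have few' x : share x 1 ord0 + share x 1 ord_max <= lam + c * d -> A1 A x <= d / 56.
  by rewrite -s1E; exact: few.
have cardI : #|{: bool * bool}| = 4%N by rewrite card_prod card_bool.
have k_ge' : 4 <= k - (c + b%:R * c / 2) by lra.
have nL_gt0 : 0 < n * L.
  by rewrite mulr_gt0 ?expR_gt0 -?nE ?expR_gt0 //; lra.
have [mu2_ge1|mu2_lt1] := leP 1 mu2.
- have w1_le : (1 - p) * mu1 <= mu2.
    have : 0 <= (mu1 - 1) * (mu2 - 1) by rewrite mulr_ge0 // subr_ge0.
    lra.
  have wlE' : wl = (1 - p) * mu1 by rewrite wlE; apply/min_idPl.
  have [small final] := facet_constants R N n L 1 (1 + mu1 + mu2) _ n2 nE (lexx 1)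
    ltac:(lra) G_ge1 k_ge'.
  rewrite -dE in small final.
  apply: le_trans final; rewrite opprB.
  (* [(false, false)] is [facetQ], [(false, true)] is [facetX], and both [(true, _)] are [facetS],
     repeated to fill four slots. *)
  pose fa (i : bool * bool) : R := match i with (false, false) => 0 | _ => 1 end.
  pose ff (i : bool * bool) : R := match i with (false, _) => 0 | _ => 1 end.
  pose fc (i : bool * bool) : R := 1.
  pose fk (i : bool * bool) : R := match i with
    | (false, false) => (c - 1 / 4) * d | (false, true) => - (lam / mu1) | _ => - lam end.
  apply: (excess_le_of_facets R N b lam mu1 mu2 p A pi _ fa ff fc fk) => //.
  + by move=> [[] []] y; rewrite /fc !inE /= ?(subr0, sub0r, subrr, opprK);
      do ?[case/orP]; move=> /eqP ->; rewrite ?normrN ?normr0 ?normr1 ?ler01 ?lexx.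
  + move=> x am i amP; split.
      rewrite mulr1; apply: (flow_sq_le1 _ _ _ _ _ _ _ _ _ _ _ (adm x am amP));
        case: i => [[] []] /=;
        by rewrite /fc ?(subr0, sub0r, subrr) ?sqrrN ?normr0 ?normr1 ?expr0n ?expr1n ?ler01 ?lexx.
    case: i => [[] []] /=.
    * exact: driftS_le1 (adm x am amP).
    * exact: driftS_le1 (adm x am amP).
    * exact: driftX_le1 (adm x am amP).
    * exact: driftQ_le1 (adm x am amP).
  + move=> x am i amP near C_le; move: near C_le (adm x am amP) (q_le x) (few' x).
    move: (share x 1 ord0) (share x 1 ord_max) (share x 2 ord0) (share x 2 ord_max)
      (queue x) => u v u2 v2 q near C_le admx qx fewx.
    have nQ := near (false, false); have nX := near (false, true).
    have nS := near (true, true); move: {near} nQ nX nS C_le.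
    case: i => [[] []] /=; rewrite /fc !mul0r !mul1r !add0r => nQ nX nS C_le.
    * by apply: (driftS_near _ _ _ _ _ _ _ _ _ _ _ admx q d c wl) => //; clear -nQ nX nS C_le; lra.
    * by apply: (driftS_near _ _ _ _ _ _ _ _ _ _ _ admx q d c wl) => //; clear -nQ nX nS C_le; lra.
    * by apply: (driftX_near _ _ _ _ _ _ _ _ _ _ _ admx q d c wl) => //; clear -nQ nX nS C_le; lra.
    * by apply: (driftQ_near _ _ _ _ _ _ _ _ _ _ _ admx q d b%:R c wl) => //; clear -nQ nX nS C_le; lra.
  + move=> x; exists (true, true); rewrite /= sumSE /fc !mul1r; lra.
- have i_ge1 : 1 <= mu2^-1 by rewrite invf_ge1 // ltW.
  have wlE' : wl = mu2.
    rewrite wlE; apply/min_idPr.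
    have := phase1_exit_ge1 R mu1 mu2 p mu1ge (ltW mu2_lt1) bal; lra.
  have w1_ge1 := phase1_exit_ge1 R mu1 mu2 p mu1ge (ltW mu2_lt1) bal.
  pose i2 := mu2^-1; pose k1 := ((1 - p) * mu1)^-1.
  have k1_ge0 : 0 <= k1 by rewrite invr_ge0 ltW.
  have k1_le1 : k1 <= 1 by rewrite invf_le1.
  have k1_w1 : k1 * ((1 - p) * mu1) = 1 by rewrite mulVf ?gt_eqF.
  have LB : 56 * mu2^-1 <= L by rewrite ler_pdivrMr.
  have [small final] := facet_constants R N n L mu2^-1 (1 + mu1 + mu2) _ n2 nE i_ge1 LB
    G_ge1 k_ge'.
  rewrite -dE in small final.
  apply: le_trans final; rewrite opprB.
  pose G := 1 + mu1 + mu2.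
  (* The workload at fluid equilibrium. Now [(true, false)] is [facetW] and [(true, true)] is
     [facetU]. *)
  pose W0 := lam / mu1 + p * lam / mu2 / mu2.
  pose fa (i : bool * bool) : R := match i with
    | (false, false) => 0 | (true, true) => 1 - k1 | _ => 1 end.
  pose ff (i : bool * bool) : R := match i with
    | (false, _) => 0 | (true, false) => i2 | (true, true) => i2 - k1 end.
  pose fc (i : bool * bool) : R := 1.
  pose fk (i : bool * bool) : R := match i with
    | (false, false) => (c - 1 / 4) * d | (false, true) => - (lam / mu1)
    | (true, false) => - W0
    | (true, true) => - W0 + k1 * (lam + (G / 4 + (1 - p) * mu1 / 4) * d) end.
  have coef_le i y : y \in [:: fa i; ff i; fc i; ff i - fa i; fa i - ff i - fc i] ->
      `|y| <= mu2^-1.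
    rewrite !inE /fc -/i2 ler_norml; move: i_ge1; rewrite -/i2 => i_ge1'.
    clear -i_ge1' k1_ge0 k1_le1; clearbody i2 k1.
    by case: i => [[] []] /=; do ?[case/orP]; move=> /eqP ->; lra.
  have sq_le i y : y \in [:: fa i; ff i; fc i; ff i - fa i; fa i - ff i - fc i] ->
      y ^+ 2 <= mu2^-1 ^+ 2.
    move=> /coef_le y_le; rewrite -real_normK ?num_real // ler_sqr ?nnegrE //.
    by rewrite invr_ge0 ltW.
  (* The differences [p lam / mu2 - v] of X and S, and [(1 / mu2 - 1) (v - p lam / mu2)] of W and S,
     cannot both be negative. *)
  have S_le (x : state N b) : let u := share x 1 ord0 in let v := share x 1 ord_max in
      u + v + queue x - lam <= u + queue x - lam / mu1 \/
      u + v + queue x - lam <= u + i2 * v + queue x - W0.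
    move=> u v; have /andP[A1_ge0 _] := A1_bounds R N b A x A_valid.
    have am0 : (0 : R) <= 0 <= A1 A x by rewrite lexx.
    have lamE := lam_split _ _ _ _ _ _ _ _ _ _ _ (adm x 0 am0).
    clear -i_ge1 lamE; rewrite /W0; move: lamE; move: (lam / mu1) (p * lam / mu2) => x0 y0 lamE.
    have [y_ge|y_lt] := leP y0 v; last by left; lra.
    right; have : 0 <= (i2 - 1) * (v - y0) by rewrite mulr_ge0 // subr_ge0.
    by rewrite -[y0 / mu2]/(y0 * i2); clearbody u v i2; lra.
  apply: (excess_le_of_facets R N b lam mu1 mu2 p A pi _ fa ff fc fk) => //.
  + move=> x am i amP; split.
      apply: (flow_sq_le_inv _ _ _ _ _ _ _ _ _ _ _ (adm x am amP)); first exact: ltW.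
      * rewrite ler_norml; clear -k1_ge0 k1_le1; clearbody k1.
        by case: i => [[] []] /=; lra.
      * by rewrite normr1.
      * by apply: (sq_le i); rewrite !inE eqxx ?orbT.
      * by apply: (sq_le i); rewrite !inE eqxx ?orbT.
      * by apply: (sq_le i); rewrite !inE eqxx ?orbT.
    case: i => [[] []] /=.
    * apply: (driftU_le1 _ _ _ _ _ _ _ _ _ _ _ (adm x am amP) k1 k1_ge0); first by rewrite k1_w1.
      exact: (mulr_ile1 k1_ge0 (ltW mu2P) k1_le1 (ltW mu2_lt1)).
    * have := driftU_le1 _ _ _ _ _ _ _ _ _ _ _ (adm x am amP) 0 (lexx 0).
      by rewrite !subr0 !mul0r; apply.
    * exact: driftX_le1 (adm x am amP).
    * exact: driftQ_le1 (adm x am amP).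
  + move=> x am i amP near C_le; move: near C_le (adm x am amP) (q_le x) (few' x) (S_le x).
    move: (share x 1 ord0) (share x 1 ord_max) (share x 2 ord0) (share x 2 ord_max)
      (queue x) => u v u2 v2 q near C_le admx qx fewx Sx.
    have nQ := near (false, false); have nX := near (false, true).
    have nW := near (true, false); have nU := near (true, true).
    move: {near} nQ nX nW nU C_le.
    have UE : (1 - k1) * u + (i2 - k1) * v + 1 * q
        + (- W0 + k1 * (lam + (G / 4 + (1 - p) * mu1 / 4) * d)) =
      u + i2 * v + q - W0 - k1 * (u + v - lam - (G / 4 + (1 - p) * mu1 / 4) * d) by ring.
    case: i => [[] []] /=; rewrite /fc UE !mul0r !mul1r !add0r ?addr0 => nQ nX nW nU C_le.
    * have := driftU_near _ _ _ _ _ _ _ _ _ _ _ admx q d c wl d_gt0 wl_gt0 c_wl fewx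
        (ltW mu2_lt1) wlE'.
      by rewrite mul1r -/W0 -/k1 -/i2 -/G; apply.
    * have := driftW_near _ _ _ _ _ _ _ _ _ _ _ admx q d.
      by rewrite -/W0 -/k1 -/i2 -/G; apply.
    * by apply: (driftX_near _ _ _ _ _ _ _ _ _ _ _ admx q d c wl) => //; rewrite div1r.
    * apply: (driftQ_near _ _ _ _ _ _ _ _ _ _ _ admx q d b%:R c wl) => //;
        rewrite div1r //.
      by case: Sx => /le_trans; apply.
  + move=> x; case: (S_le x) => S_le_x; [exists (false, true) | exists (true, false)];
      by rewrite /= sumSE /fc !mul1r ?mul0r ?addr0.
Qed.

(** * Consequences of the bounds on [log N] and the value of [k] *)

Theorem theorem1 (R : realType) (N b : nat) (alpha mu1 mu2 p : R)
  (A : policy N b R) (pi : state N b -> R) :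
  0 < alpha -> alpha < 1 / 2 ->
  0 < mu1 -> 0 < mu2 -> 0 <= p -> p < 1 ->
  1 / mu1 + p / mu2 = 1 ->
  let lam := 1 - (N%:R) `^ (- alpha) in
  valid_policy A ->
  irreducible lam mu1 mu2 p A ->
  in_Pi lam mu1 mu2 p A ->
  stationary lam mu1 mu2 p A pi ->
  let wu := Num.max ((1 - p) * mu1) mu2 in
  let wl := Num.min ((1 - p) * mu1) mu2 in
  let mumax := Num.max mu1 mu2 in
  let k := (1 + wu * b%:R / wl) * ((1 + mu1 + mu2) / wl + 2 * mu1) in
  wl * (N%:R) `^ (1 / 2 - alpha) / (1 + mu1 + mu2) >= ln (N%:R) ->
  ln (N%:R) >= (7 / 2) / Num.min (mu1 / (16 * mumax))
                          (Num.min (mu2 / (12 * mumax)) (mu1 * mu2 / (40 * mumax))) ->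
  \sum_x pi x * Num.max (sumS x - lam - k * ln (N%:R) / Num.sqrt (N%:R)) 0
    <= 7 * mumax / (Num.sqrt (N%:R) * ln (N%:R)).
Proof.
move=> alpha_gt0 alpha_lt mu1_gt0 mu2_gt0 p_ge0 p_lt1 unit_mean lam A_valid _ A_Pi pi_stat
  wu wl mumax k.
set L := ln N%:R => L_le L_ge.
have bal : mu1 * mu2 = mu2 + p * mu1.
  have -> : mu1 * mu2 = mu1 * mu2 * (1 / mu1 + p / mu2) by rewrite unit_mean mulr1.
  by field; rewrite !gt_eqF.
have mu1ge := mu1_ge1 R mu1 mu2 p mu1_gt0 mu2_gt0 p_ge0 bal.
clear unit_mean.
have mu1_le : mu1 <= mumax by rewrite le_max lexx.
have mumax_gt0 : 0 < mumax by lra.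
have m_gt0 : 0 < Num.min (mu1 / (16 * mumax))
    (Num.min (mu2 / (12 * mumax)) (mu1 * mu2 / (40 * mumax))).
  by rewrite !lt_min !divr_gt0 ?mulr_gt0 ?ltr0n.
have L_gt0 : 0 < L by apply: lt_le_trans L_ge; rewrite divr_gt0 // divr_gt0.
have L_min y : 0 < y -> Num.min (mu1 / (16 * mumax))
    (Num.min (mu2 / (12 * mumax)) (mu1 * mu2 / (40 * mumax))) <= y -> 7 / 2 <= L * y.
  move=> y_gt0 le_y; rewrite -ler_pdivrMr //; apply: le_trans L_ge.
  by rewrite ler_pM2l ?lef_pV2 ?posrE //; lra.
(* [56 = 7 / 2 * 16], from the first entry of the minimum. *)
have L56 : 56 <= L.
  have : 7 / 2 <= L * (mu1 / (16 * mumax)).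
    by apply: L_min; rewrite ?divr_gt0 ?mulr_gt0 // ge_min lexx.
  have : mu1 / (16 * mumax) <= 16^-1.
    by rewrite ler_pdivrMr ?mulr_gt0 //; lra.
  move=> le16 leL; have : L * (mu1 / (16 * mumax)) <= L * 16^-1 by rewrite ler_pM2l.
  lra.
(* If [mu2 < 1 <= mu1] then [mumax = mu1], and the third entry gives [L * mu2 >= 140]. *)
have Lmu2 : 56 <= L * mu2.
  have [mu2_ge1|mu2_lt1] := leP 1 mu2; first by apply: le_trans L56 _; rewrite ler_peMr // ltW.
  have : 7 / 2 <= L * (mu1 * mu2 / (40 * mumax)).
    by apply: L_min; rewrite ?divr_gt0 ?mulr_gt0 // !ge_min lexx !orbT.
  have -> : mumax = mu1 by apply/max_idPl; lra.
  have -> : L * (mu1 * mu2 / (40 * mu1)) = L * mu2 / 40 by field; rewrite gt_eqF.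
  lra.
(* [ln 0 = 0] by convention, so [L > 0] excludes [N = 0]. *)
have N_gt0 : (0 < N)%N.
  by rewrite lt0n; apply: contraTneq L_gt0 => N0; rewrite /L N0 ln0 // ltxx.
have NR_gt0 : 0 < N%:R :> R by rewrite ltr0n.
have powE y : N%:R `^ y = expR (y * L) :> R by rewrite /powR gt_eqF.
have nE : expR (L / 2) = Num.sqrt N%:R.
  have -> : N%:R = expR (L / 2) ^+ 2 :> R.
    rewrite expr2 -expRD; have -> : L / 2 + L / 2 = L by field.
    by rewrite lnK ?posrE.
  by rewrite sqrtr_sqr ger0_norm ?expR_ge0.
set n := Num.sqrt N%:R in nE *.
have n2 : n ^+ 2 = N%:R by rewrite sqr_sqrtr // ltW.
have n_gt0 : 0 < n by rewrite -nE expR_gt0.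
have w1_gt0 : 0 < (1 - p) * mu1 by rewrite mulr_gt0 // subr_gt0.
have wl_gt0 : 0 < wl by rewrite lt_min w1_gt0.
have wl_le_mu2 : wl <= mu2 by rewrite ge_min lexx orbT.
have G_gt0 : 0 < 1 + mu1 + mu2 by lra.
have lamP : 0 <= lam <= 1.
  rewrite /lam powE subr_ge0 lerBlDr lerDl expR_ge0 andbT -expR0 ler_expR mulNr oppr_le0.
  by rewrite mulr_ge0 // ltW.
(* This is [d <= 1], from [wl <= 1 + mu1 + mu2] and [N ^ (1 / 2 - alpha) <= sqrt N]. *)
have Ln : L <= n.
  apply: le_trans L_le _; rewrite ler_pdivrMr // powE mulrC.
  apply: ler_pM; rewrite ?expR_ge0 ?(ltW wl_gt0) //; last by lra.
  rewrite -nE ler_expR.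
  have : 0 <= alpha * L by rewrite mulr_ge0 // ltW.
  lra.
have kE : k * L / n = k * (L / n) by rewrite mulrA.
rewrite {}kE.
have target : 7 / (n * L) <= 7 * mumax / (n * L).
  by rewrite ler_pM2r ?invr_gt0 ?mulr_gt0 //; lra.
apply: le_trans target.
(* For [b = 0] the total is an empty sum, and [- lam - k d <= 0]. *)
have [b0|b_gt0] := posnP b.
  rewrite big1 ?divr_ge0 ?mulr_ge0 ?ltW // => x _.
  have -> : sumS x = 0 :> R.
    by rewrite /sumS big1 // => i _; have := ltn_ord i; rewrite {2}b0.
  have k_ge0 : 0 <= k * (L / n).
    rewrite mulr_ge0 ?divr_ge0 ?ltW // mulr_gt0 //.
      rewrite b0 mulr0 mul0r addr0 //.
    by rewrite addr_gt0 ?divr_gt0 ?mulr_gt0.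
  have -> : Num.max (0 - lam - k * (L / n)) 0 = 0.
    by apply/max_idPr; case/andP: lamP; lra.
  by rewrite mulr0.
apply: (excess_le R N b lam mu1 mu2 p (L / n) n L ((1 + mu1 + mu2) / wl) wl k A pi) => //.
- by rewrite p_ge0.
- by rewrite divr_gt0 //= ler_pdivrMr // mul1r.
- by rewrite mulfVK // gt_eqF.
- move=> x s1_le; apply: le_trans (A_Pi x _) _; first by rewrite -[leRHS]/(_ + _) -mulrA.
  by rewrite -/n mul1r mulrAC ler_peMl ?invr_ge0 ?(ltW n_gt0) //; lra.
set c := _ / wl.
have c_gt0 : 0 < c by rewrite divr_gt0.
have b_ge1 : 1 <= b%:R :> R by rewrite ler1n.
have ratio : b%:R <= wu * b%:R / wl.
  rewrite ler_pdivlMr // [wu * _]mulrC ler_wpM2l // /wu /wl.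
  by apply: le_trans (_ : mu2 <= _) => //; rewrite le_max lexx orbT.
(* Here [wu >= wl]; with [b, mu1 >= 1] the terms [2 mu1 + 2 b mu1] supply the margin 4 that becomes
   the decay constant [Ck]. *)
have : (1 + b%:R) * (c + 2 * mu1) <= k.
  rewrite /k -/c ler_wpM2r ?lerD2l //; lra.
have : 0 <= c * b%:R by rewrite mulr_ge0 // ltW.
have : 1 <= b%:R * mu1 by rewrite mulr_ege1.
lra.
Qed.
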